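(* The numbers $T_N(e; d_1, \dotsc, d_s)$ of $N$-rooted plane trees with $e$ edges, where $s$ of the $N$ ordered root vertices are specified to be of degrees $d_1,\dotsc,d_s$, respectively, with $d_i\ge 0$, satisfy the following recursion: $$T_N(e; d_1, \dotsc, d_{N-1}, d_N) = \sum_{i=1}^{N-1} d_i\, T_{N-1}(e-1;d_1, \dots, d_{i-1}, d_i+d_N-2,d_{i+1}, \dots, d_{N-1}) + T_N(e-1; d_1, \dots, d_{N-1}) - \sum_{d=1}^{d_N-2}T_N(e-1; d_1, \dots, d_{N-1}, d).$$ Here it is assumed that $T_M(n; n_1, \dots, n_k)$ is zero if its parameters do not satisfy the necessary conditions (i)-(iv) listed in the context.
   Context: A plane tree with $e\ge1$ edges is a triple $\Gamma=(H,\alpha,\sigma)$, where $H$ is a set of $2e$ half-edges and $\alpha,\sigma$ are permutations of $H$ such that $\alpha$ is a fixed-point-free involution, the group generated by $\alpha,\sigma$ acts transitively on $H$, and $\sigma$ has exactly $e+1$ cycles (fixed points counted as cycles). Cycles of $\alpha$ are the edges, cycles of $\sigma$ are the vertices (with the cyclic order of half-edges around them), and the degree of a vertex is the length of its cycle. An $N$-rooted tree ($N\ge1$) is a plane tree together with $N$ distinct half-edges (roots) belonging to $N$ distinct cycles of $\sigma$; the corresponding $N$ vertices (root vertices) are labeled $v_1,\dots,v_N$. An isomorphism of $N$-rooted trees $(H,\alpha,\sigma)\to(H',\alpha',\sigma')$ is a bijection $\varphi:H\to H'$ with $\alpha=\varphi^{-1}\alpha'\varphi$, $\sigma=\varphi^{-1}\sigma'\varphi$,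 sending the $k$th root to the $k$th root for all $k$. Isomorphic trees are identified. As an exceptional case, the graph with a single vertex (of degree $0$) and no edges is also considered a one-rooted plane tree, with $e=0$. $T_N(e;d_1,\dots,d_k)$, $0\le k\le N$, is the number of $N$-rooted plane trees with $e$ edges in which the root vertex $v_j$ has degree $d_j$ for $j=1,\dots,k$ (the degrees of the other root vertices are not specified); $T_N(e)$ is the case $k=0$. In particular $T_1(0)=T_1(0;0)=1$. The necessary conditions on the integers $e,N,d_i$ for $T_N(e;d_1,\dots,d_k)$, $k\le N$, are: (i) $e\ge N-1$ and $N\ge1$; (ii) $0<d_i\le e$, except for the case $N=1$, $e=d_1=0$, where $T_1(0;0)=1$; (iii) $\sum_{i=1}^k d_i\le e+k-1$, where $k=N=e+1$ if and only if $\sum_{i=1}^N d_i=2e$; (iv) if $e\ge2$, then $|\{i : d_i=1,\ 1\le i\le k\}|\le e$; if $e=1$, then $|\{i : d_i=1,\ 1\le i\le 2\}|\le 2$. The number $T_N(e;d_1,\dots,d_k)$ is defined to be zero if these conditions are not satisfied.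
   Formalization: The recursion is stated for d_N ≥ 1 and excludes N = e = 1 with d_N ≥ 2, because it fails under the zero convention otherwise: T_1(1;0) = 0 but the right side is T_1(0) = 1; T_1(0;0) = 1 but the right side is 0; T_1(1;2) = 0 but the right side is 1. *)

(* Defs.v *)
From mathcomp Require Import all_boot all_order all_algebra all_fingroup.

Set Implicit Arguments.
Unset Strict Implicit.
Unset Printing Implicit Defensive.

Import Order.TTheory GRing.Theory Num.Theory.

Local Open Scope ring_scope.

Definition plane_tree (H : finType) (e : nat) (alpha sigma : {perm H}) : bool :=
  [&& #|H| == e.*2,
      [forall x, (alpha (alpha x) == x) && (alpha x != x)],
      [transitive <<[set alpha; sigma]>>%g, on [set: H] | 'P]
    & #|porbits sigma| == e.+1].

(* ((alpha, sigma), r) with r the tuple of the N roots. *)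
Definition rooted_datum (H : finType) (N : nat) : finType :=
  ({perm H} * {perm H} * N.-tuple H)%type.

(* Roots in pairwise distinct cycles are in particular pairwise distinct. *)
Definition rooted_tree (H : finType) (e N : nat) (t : rooted_datum H N) : bool :=
  let: (alpha, sigma, r) := t in
  plane_tree e alpha sigma && uniq [seq porbit sigma x | x <- r].

(* Products of permutations apply the left factor first, so
   phi * alpha' * phi^-1 is the map x |-> phi^-1 (alpha' (phi x)). *)
Definition rooted_iso (H : finType) (N : nat) (t t' : rooted_datum H N) : bool :=
  let: (alpha, sigma, r) := t in
  let: (alpha', sigma', r') := t' in
  [exists phi : {perm H},
    [&& alpha == (phi * alpha' * phi^-1)%g,
        sigma == (phi * sigma' * phi^-1)%g
      & [seq phi x | x <- r] == r' :> seq H]].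

Definition degrees_spec (H : finType) (N : nat) (d : seq nat)
    (t : rooted_datum H N) : bool :=
  let: (_, sigma, r) := t in
  [seq #|porbit sigma x| | x <- take (size d) r] == d.

(* The number of isomorphism classes, for e >= 1. Every set of 2e half-edges is
   in bijection with 'I_(e.*2), so this carrier represents every class. *)
Definition tree_classes (N e : nat) (d : seq nat) : nat :=
  #|equivalence_partition (@rooted_iso 'I_(e.*2) N)
      [set t | rooted_tree e t && degrees_spec d t]|.

(* The exceptional tree: one vertex, no edge, one root vertex of degree 0. *)
Definition trivial_case (N : nat) (e : int) (d : seq int) : bool :=
  [&& N == 1%N, e == 0 & d \in [:: [::]; [:: 0]]].

(* The necessary conditions on the parameters when trivial_case fails; d = [::]
   with e = 0 has to be a trivial case, as it violates the bound on the sum. *)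
Definition necessary (N : nat) (e : int) (d : seq int) : bool :=
  let k := size d in
  [&& (k <= N)%N,
      (N%:Z - 1 <= e) && (1 <= N)%N,
      all (fun x => (0 < x) && (x <= e)) d,
      (\sum_(x <- d) x <= e + k%:Z - 1) &&
        (((k == N) && (N%:Z == e + 1)) == (\sum_(x <- d) x == e *+ 2)),
      (2 <= e) ==> ((count (pred1 (1 : int)) d)%:Z <= e)
    & (e == 1) ==> (count (pred1 (1 : int)) (take 2 d) <= 2)%N].

(* T_N(e; d_1, ..., d_k) for k = size d. The parameters e and d_i are integers
   because the recursion may shift them below zero; absz is only applied
   to nonnegative values here. *)
Definition T (N : nat) (e : int) (d : seq int) : nat :=
  if trivial_case N e d then 1%N
  else if necessary N e d then tree_classes N (absz e) (map absz d)
  else 0%N.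

(* Main.v *)
Require Import Defs.
From mathcomp Require Import all_boot all_order all_algebra all_fingroup.
From mathcomp Require Import zify.

(** The recursion is edge contraction. Let [h] be the root of the last root
    vertex [v_N] of a tree with [e] edges and [h'] the other half of its edge.
    A tree has no loop ([tree_no_loop]), so [h'] lies at another vertex [w], and
    contracting the edge merges [v_N] and [w] into a vertex of degree
    [deg v_N + deg w - 2], giving a tree with [e - 1] edges. Root the merged
    vertex at its first half-edge, when the half-edges of [v_N] after [h] are
    listed first and those of [w] after [h'] next. Since [deg v_N] is known, the
    place to cut is known too, and the tree can be recovered from the rooted
    contraction: contraction is a bijection onto the trees whose new root vertex
    has degree at least [d_N - 1] ([plane_tree_expand], [expand_surj],
    [expand_vertex_inj]).

    The other roots are then placed ([card_roots_off_expand]). If [w] is not a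
    root vertex, the new root is an additional one, of any degree at least
    [d_N - 1]; these trees are all the trees with [e - 1] edges, [N] roots and
    unspecified last degree, minus those with last degree at most [d_N - 2]. If [w] is [v_i], the
    merged vertex replaces [v_i], and the contraction forgets which of the
    [d_i] half-edges of [w] was the root. This gives the three parts of the
    right-hand side.

    The count is carried out on trees whose half-edges are labelled by ['I_(2e)].
    An automorphism of a tree that fixes a root is the identity, so each class has
    [(2e)!] labelled trees ([card_labelled_trees]); fixing the labels of [h] and
    [h'] divides the count by [2e(2e-1)] ([card_labelled_marked]), which is
    exactly the ratio of [(2e)!] to [(2(e-1))!].

    Contraction needs a half-edge left to carry the new root, so it applies for
    [e >= 2]. The single tree with one edge is counted by hand, and for [e <= 0]
    all the terms vanish. Finally, the necessary conditions hold as soon as one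
    tree exists ([tree_classes_necessary]), so for [e >= 1] they do not change
    the counts ([T_pos]). *)

Set Implicit Arguments.
Unset Strict Implicit.
Unset Printing Implicit Defensive.

(** * Cycles of a permutation multiplied by a transposition *)

Section Cycles.

Variable H : finType.
Implicit Types (s : {perm H}) (A : {set H}).

Definition stable s A : Prop := forall x, (s x \in A) = (x \in A).

Lemma stable_iter s A k x : stable s A -> ((s ^+ k)%g x \in A) = (x \in A).
Proof.
by move=> sA; elim: k => [|k IHk]; rewrite ?perm1 // expgSr permM sA.
Qed.

Lemma stable_porbit s A x y :
  stable s A -> y \in porbit s x -> (y \in A) = (x \in A).
Proof. by move=> sA /porbitP[k ->]; apply: stable_iter. Qed.

Lemma porbit_stable s x : stable s (porbit s x).
Proof.
move=> y; rewrite -!eq_porbit_mem.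
by have := porbit_perm s 1 y; rewrite expg1 => ->.
Qed.

Lemma porbit_sub_stable s A x :
  stable s A -> x \in A -> porbit s x \subset A.
Proof. by move=> sA xA; apply/subsetP => y /(stable_porbit sA) ->. Qed.

Lemma stable_mul_tperm s A x y :
  stable s A -> (x \in A) = (y \in A) -> stable (s * tperm x y)%g A.
Proof.
move=> sA xy z; rewrite permM -(sA z).
by case: tpermP => [->|->|].
Qed.

Lemma card_porbits_mul_tperm s x y :
  #|porbits (s * tperm x y)%g| + (x \notin porbit s y).*2
    = #|porbits s| + (x != y).
Proof.
rewrite -porbitsV invMg tpermV -[porbits s]porbitsV -(porbits_mul_tperm s^-1).
by rewrite (porbitV s).
Qed.

Lemma porbit_mul_tperm_out s x y z :
    x \notin porbit s z -> y \notin porbit s z ->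
  porbit (s * tperm x y)%g z = porbit s z.
Proof.
move=> xz yz; suff E k : ((s * tperm x y) ^+ k)%g z = (s ^+ k)%g z.
  by apply/setP=> u; apply/porbitP/porbitP => -[k ->]; exists k; rewrite E.
elim: k => [|k IHk]; rewrite ?expg0 // !expgSr !permM IHk.
have sk : s ((s ^+ k)%g z) \in porbit s z by rewrite -permM -expgSr mem_porbit.
by rewrite tpermD //; [apply: contraNneq xz | apply: contraNneq yz] => ->.
Qed.

(** Forced by the count of cycles, applied to [s] and to [s * tperm x y]. *)
Lemma mem_porbit_mul_tperm s x y :
  x != y -> (x \in porbit (s * tperm x y)%g y) = (x \notin porbit s y).
Proof.
move=> xy; have := card_porbits_mul_tperm s x y.
have := card_porbits_mul_tperm (s * tperm x y)%g x y.
rewrite -mulgA tperm2 mulg1 xy; case: (_ \in _); case: (_ \in _) => //=; lia.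
Qed.

Lemma porbit_mul_tperm_merge s x y :
    x \notin porbit s y ->
  porbit (s * tperm x y)%g x = porbit s x :|: porbit s y.
Proof.
move=> xNy; have xy : x != y by apply: contraNneq xNy => ->; apply: porbit_id.
have yx : y \in porbit (s * tperm x y)%g x.
  by rewrite porbit_sym mem_porbit_mul_tperm.
have xx := porbit_id (s * tperm x y)%g x.
apply/eqP; rewrite eqEsubset; apply/andP; split; last first.
  have st : stable s (porbit (s * tperm x y)%g x).
    rewrite -{1}[s](mulgK (tperm x y)) tpermV; apply: stable_mul_tperm.
      exact: porbit_stable.
    by rewrite xx yx.
  by rewrite subUset !porbit_sub_stable.
apply: porbit_sub_stable; last by rewrite inE porbit_id.
apply: stable_mul_tperm; last by rewrite !inE !porbit_id orbT.
by move=> z; rewrite !inE !porbit_stable.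
Qed.

Lemma porbit_fix s x : s x = x -> porbit s x = [set x].
Proof.
move=> sx; apply/eqP; rewrite eqEsubset sub1set porbit_id andbT.
apply: porbit_sub_stable; rewrite ?set11 // => z.
by rewrite !inE -{1}sx (inj_eq perm_inj).
Qed.

Lemma expg_porbit_inj s x i j :
    i < #|porbit s x| -> j < #|porbit s x| -> (s ^+ i)%g x = (s ^+ j)%g x ->
  i = j.
Proof.
move=> ic jc; rewrite !permX -(nth_traject s ic x) -(nth_traject s jc x).
by move/eqP; rewrite nth_uniq ?size_traject ?uniq_traject_porbit // => /eqP.
Qed.

Lemma card_porbit_first_return s x m :
    0 < m -> (s ^+ m)%g x = x ->
    (forall k, 0 < k < m -> (s ^+ k)%g x != x) ->
  #|porbit s x| = m.
Proof.
move=> m0 sm min; have c0 : 0 < #|porbit s x| by rewrite lt0n card_porbit_neq0.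
case: (ltngtP #|porbit s x| m) => // [cm|mc].
  have := min _ (introT andP (conj c0 cm)).
  by rewrite permX iter_porbit eqxx.
suff : m = 0 by lia.
by apply: (expg_porbit_inj (s := s) (x := x)) => //; rewrite sm perm1.
Qed.

End Cycles.

(** * Plane trees as connected pairs of permutations *)

Section Trees.

Variable H : finType.
Implicit Types (alpha sigma : {perm H}) (A : {set H}).

Definition joined alpha sigma : Prop :=
  forall A, stable alpha A -> stable sigma A ->
  forall x y, x \in A -> y \in A.

Definition matching alpha : Prop :=
  forall x, alpha (alpha x) = x /\ alpha x != x.

(** Transitivity is used through the sets of half-edges stable under both
    permutations: these are easy to follow through a contraction, unlike words
    in the generators. *)
Lemma plane_treeP e alpha sigma :
  reflect [/\ #|H| = e.*2, matching alpha, joined alpha sigma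
            & #|porbits sigma| = e.+1]
          (plane_tree e alpha sigma).
Proof.
apply: (iffP and4P) => [[/eqP cH /forallP ma tr /eqP cs]|[cH ma jo cs]].
  split=> // [x | A aA sA x y xA]; first by case/andP: (ma x) => /eqP.
  have := in_setT y; rewrite -(atransP tr x (in_setT x)) => /orbitP[g gG <-].
  suff /subsetP/(_ _ gG)/astabsP-> : <<[set alpha; sigma]>>%g \subset 'N(A | 'P)%g
    by [].
  rewrite gen_subG; apply/subsetP => s.
  by rewrite !inE => /orP[]/eqP->; apply/subsetP => z zA; rewrite inE /= apermE
     ?aA ?sA.
split; rewrite ?cH ?cs //.
  by apply/forallP=> x; have [-> ->] := ma x; rewrite eqxx.
have /card_gt0P[_ /imsetP[x _ _]] : 0 < #|porbits sigma| by rewrite cs.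
apply/imsetP; exists x => //; apply/esym/eqP; rewrite -subTset.
apply/subsetP => y _; apply: jo (orbit_refl _ _ x) => z.
  by apply: (orbit_actr 'P) => /=; rewrite mem_gen ?set21.
by apply: (orbit_actr 'P) => /=; rewrite mem_gen ?set22.
Qed.

(** Multiplying by a transposition glues two cycles, so joining the vertices
    along the edges listed in [l] costs at most one vertex for each edge. *)
Lemma glue_cycles alpha sigma (l : seq H) :
  exists2 tau : {perm H}, #|porbits sigma| <= #|porbits tau| + size l
  & forall A, stable tau A ->
      stable sigma A /\ {in l, forall x, (alpha x \in A) = (x \in A)}.
Proof.
elim: l => [|a l [tau le_tau tau_st]]; first by exists sigma; rewrite ?addn0.
have [loop|apart] := boolP (alpha a \in porbit tau a).
  exists tau => [|A tA]; first by rewrite (leq_trans le_tau) //= addnS.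
  have [sA lA] := tau_st A tA; split=> // x; rewrite inE => /predU1P[->|/lA//].
  exact: stable_porbit tA loop.
exists (tau * tperm (alpha a) a)%g => [|A tA].
  have := card_porbits_mul_tperm tau (alpha a) a; rewrite apart.
  suff -> : alpha a != a.
    rewrite /= -addnn; move: le_tau.
    by do 3!move: #|porbits _|; move=> u v w; lia.
  by apply: contraNneq apart => ->; apply: porbit_id.
have aA : (alpha a \in A) = (a \in A).
  apply: stable_porbit tA _; rewrite porbit_sym porbit_mul_tperm_merge //.
  by rewrite inE porbit_id orbT.
have [|sA lA] := tau_st A.
  by rewrite -[tau](mulgK (tperm (alpha a) a)) tpermV; apply: stable_mul_tperm.
by split=> // x; rewrite inE => /predU1P[->|/lA].
Qed.

End Trees.

Lemma card_half_matching n (alpha : {perm 'I_n}) :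
  matching alpha -> #|[set x : 'I_n | x < alpha x]|.*2 = n.
Proof.
move=> ma; set R := [set x | _].
have E : alpha @: R = ~: R.
  apply/setP=> y; have [aay ney] := ma y.
  rewrite -{1}aay (mem_imset _ _ perm_inj) !inE aay.
  by rewrite -leqNgt ltn_neqAle ney.
by rewrite -addnn -{2}(card_imset (mem R) (@perm_inj _ alpha)) E cardsC card_ord.
Qed.

(** A connected graph with [e.+1] vertices has at least [e] edges which are not
    loops, so none of the [e] edges of a tree is a loop. *)
Lemma tree_no_loop e (alpha sigma : {perm 'I_e.*2}) x :
  plane_tree e alpha sigma -> alpha x \notin porbit sigma x.
Proof.
case/plane_treeP=> _ ma jo cs; apply/negP => loop.
pose R := [set x : 'I_e.*2 | x < alpha x].
have cR : #|R| = e by apply: double_inj; rewrite card_half_matching.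
wlog xR : x loop / x \in R.
  move=> IH; have [xR|] := boolP (x \in R); first exact: IH loop xR.
  have [aax nex] := ma x.
  rewrite !inE -leqNgt leq_eqVlt (inj_eq val_inj) (negPf nex) /= => lt_ax.
  by apply: (IH (alpha x)); rewrite ?inE aax // porbit_sym.
have [tau le_tau tau_st] := glue_cycles alpha sigma (enum (R :\ x)).
have tau_full A : stable tau A -> forall y z, y \in A -> z \in A.
  move=> tA; have [sA lA] := tau_st A tA; apply: jo => // y.
  have aR : {in R, forall z, (alpha z \in A) = (z \in A)}.
    move=> z zR; have [->|zx] := eqVneq z x; first exact: stable_porbit loop.
    by apply: lA; move: zR; rewrite mem_enum !inE zx.
  have [yR|] := boolP (y \in R); first exact: aR.
  have [aay ney] := ma y.
  rewrite !inE -leqNgt leq_eqVlt (inj_eq val_inj) (negPf ney) /= => lt_ay.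
  by rewrite -(aR (alpha y)) ?inE aay.
suff : #|porbits tau| <= 1.
  move: le_tau; rewrite -cardE cs -{1}cR (cardsD1 x R) xR add1n -addn2 addnC.
  by rewrite leq_add2r => /leq_trans/[apply].
apply/card_le1_eqP => _ _ /imsetP[y _ ->] /imsetP[z _ ->].
apply/eqP; rewrite eq_porbit_mem.
exact: (tau_full _ (@porbit_stable _ tau y) y z (porbit_id _ _)).
Qed.

(** * Relabelling half-edges *)

Lemma porbit_intertwine (H H' : finType) (f : H' -> H) (s : {perm H})
    (s' : {perm H'}) y :
  (forall z, s (f z) = f (s' z)) -> porbit s (f y) = f @: porbit s' y.
Proof.
move=> sf; have sfk k : (s ^+ k)%g (f y) = f ((s' ^+ k)%g y).
  by elim: k => [|k IHk]; rewrite ?perm1 // !expgSr !permM IHk.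
apply/setP=> x; apply/porbitP/imsetP => [[k ->]|[z /porbitP[k ->] ->]].
  by exists ((s' ^+ k)%g y); rewrite ?mem_porbit.
by exists k.
Qed.

Section Relabel.

Variable H : finType.
Implicit Types (alpha sigma phi : {perm H}).

Lemma porbitJ sigma phi x : porbit (sigma ^ phi)%g (phi x) = phi @: porbit sigma x.
Proof. by apply: porbit_intertwine => z; rewrite permJ. Qed.

Lemma card_porbitJ sigma phi x : #|porbit (sigma ^ phi)%g (phi x)| = #|porbit sigma x|.
Proof. by rewrite porbitJ card_imset //; apply: perm_inj. Qed.

Lemma eq_porbitJ sigma phi x y :
  (porbit (sigma ^ phi)%g (phi x) == porbit (sigma ^ phi)%g (phi y))
    = (porbit sigma x == porbit sigma y).
Proof. by rewrite !eq_porbit_mem porbitJ (mem_imset _ _ perm_inj). Qed.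

Lemma card_porbitsJ sigma phi : #|porbits (sigma ^ phi)%g| = #|porbits sigma|.
Proof.
have -> : porbits (sigma ^ phi)%g = (fun A : {set H} => phi @: A) @: porbits sigma.
  apply/setP=> A; apply/imsetP/imsetP => [[x _ ->]|[_ /imsetP[x _ ->] ->]].
    by exists (porbit sigma (phi^-1%g x)); rewrite ?imset_f //= -porbitJ permKV.
  by exists (phi x); rewrite //= porbitJ.
by rewrite card_imset //; apply: imset_inj; apply: perm_inj.
Qed.

Lemma plane_treeJ_imp e alpha sigma phi :
  plane_tree e alpha sigma -> plane_tree e (alpha ^ phi)%g (sigma ^ phi)%g.
Proof.
case/plane_treeP=> cH ma jo cs; apply/plane_treeP; split=> //.
- move=> x; rewrite -[x](permKV phi) !permJ (inj_eq perm_inj).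
  by have [-> ->] := ma (phi^-1%g x).
- move=> A aA sA x y; have aux s : stable (s ^ phi)%g A -> stable s (phi @^-1: A).
    by move=> stA z; rewrite !inE -permJ stA.
  move/jo: (aux _ aA) => /(_ (aux _ sA) (phi^-1%g x) (phi^-1%g y)).
  by rewrite !inE !permKV.
- by rewrite card_porbitsJ.
Qed.

Lemma plane_treeJ e alpha sigma phi :
  plane_tree e (alpha ^ phi)%g (sigma ^ phi)%g = plane_tree e alpha sigma.
Proof.
apply/idP/idP => [/(@plane_treeJ_imp _ _ _ phi^-1%g)|]; rewrite ?conjgK //.
exact: plane_treeJ_imp.
Qed.

(** The set of half-edges where two relabellings agree is stable under both
    permutations, so it is everything once it is not empty. *)
Lemma joined_faithful alpha sigma phi psi x :
    joined alpha sigma ->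
    (alpha ^ phi = alpha ^ psi)%g -> (sigma ^ phi = sigma ^ psi)%g ->
  phi x = psi x -> phi = psi.
Proof.
move=> jo Ea Es Ex; pose A := [set y | phi y == psi y].
have aux (s : {perm H}) : (s ^ phi = s ^ psi)%g -> stable s A.
  move=> E; have sub y : y \in A -> s y \in A.
    by rewrite !inE => /eqP Ey; rewrite -(permJ s phi y) -(permJ s psi y) E Ey.
  move=> y; apply/idP/idP => [sy|/sub//].
  have -> : y = (s ^+ #|porbit s y|)%g y by rewrite permX iter_porbit.
  case: #|porbit s y| (card_porbit_neq0 s y) => // n _.
  rewrite expgS permM; elim: n => [|n IHn]; first by rewrite perm1.
  by rewrite expgSr permM sub.
apply/permP=> y; apply/eqP; have : x \in A by rewrite inE Ex.
by move/(jo A (aux _ Ea) (aux _ Es) x y); rewrite inE.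
Qed.

End Relabel.

(** * Counting trees with labelled half-edges *)

Definition labelled_trees (N e : nat) (d : seq nat) : {set rooted_datum 'I_e.*2 N} :=
  [set t | rooted_tree e t && degrees_spec d t].

Section Classes.

Variables (N e : nat) (d : seq nat).
Notation H := 'I_e.*2.
Implicit Types t : rooted_datum H N.

Definition relabel (phi : {perm H}) t : rooted_datum H N :=
  (t.1.1 ^ phi, t.1.2 ^ phi, map_tuple phi t.2)%g.

Lemma rooted_isoE t t' : rooted_iso t t' = [exists phi, t' == relabel phi t].
Proof.
case: t t' => [[a s] r] [[a' s'] r']; apply: eq_existsb => phi.
have E (b b' : {perm H}) : (b == phi * b' * phi^-1)%g = (b' == b ^ phi)%g.
  by apply/eqP/eqP => ->; rewrite conjgE ?mulgA ?mulgV ?mul1g ?mulgK // -!mulgA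
    mulVg mulg1 mulKg.
rewrite /relabel /= !xpair_eqE andbA !E; congr (_ && _).
by rewrite eq_sym.
Qed.

Lemma relabel_mem phi t :
  (relabel phi t \in labelled_trees N e d) = (t \in labelled_trees N e d).
Proof.
case: t => [[a s] r]; rewrite !inE /relabel /= plane_treeJ -map_take -!map_comp.
congr (_ && _ && _).
  elim: (r : seq H) => //= x l ->; congr (~~ _ && _).
  apply/mapP/mapP => -[y yl /eqP /= E]; exists y => //; apply/eqP.
    by rewrite eq_porbitJ in E.
  by rewrite eq_porbitJ.
by congr (_ == _); apply: eq_map => x /=; rewrite card_porbitJ.
Qed.

Lemma relabel_inj t : 0 < N -> t \in labelled_trees N e d -> injective (relabel^~ t).
Proof.
case: t => [[a s] r] N0 tD phi psi []; move: tD.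
rewrite inE => /andP[/andP[/plane_treeP[_ _ jo _] _] _] Ea Es.
case: r => -[|x l] /=; first by move=> /eqP N0'; rewrite -N0' in N0.
by move=> _ [Ex _]; apply: joined_faithful Ea Es Ex.
Qed.

(** A rooted tree has no automorphism but the identity, so each isomorphism
    class contains [(2e)!] labelled trees. *)
Lemma card_labelled_trees :
  0 < N -> #|labelled_trees N e d| = tree_classes N e d * (e.*2)`!.
Proof.
move=> N0; set D := labelled_trees N e d.
have relM t phi psi : relabel psi (relabel phi t) = relabel (phi * psi)%g t.
  case: t => [[a s] r]; rewrite /relabel /= !conjgM; congr (_, _, _).
  by apply: val_inj; rewrite /= -map_comp; apply: eq_map => x; rewrite /= permM.
have rel1 t : relabel 1%g t = t.
  case: t => [[a s] r]; rewrite /relabel /= !conjg1; congr (_, _, _).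
  by apply: val_inj; rewrite /= -[RHS]map_id; apply: eq_map => x; rewrite perm1.
have eqv : {in D & &, equivalence_rel (@rooted_iso H N)}.
  move=> t u v _ _ _; rewrite !rooted_isoE; split.
    by apply/existsP; exists 1%g; rewrite rel1.
  case/existsP=> phi /eqP->; apply/existsP/existsP => -[psi /eqP->].
    by exists (phi^-1 * psi)%g; rewrite relM mulKVg.
  by exists (phi * psi)%g; rewrite relM.
apply: card_uniform_partition (equivalence_partitionP eqv) => _ /imsetP[t tD ->].
have -> : [set u in D | rooted_iso t u] = relabel^~ t @: [set: {perm H}].
  apply/setP=> u; rewrite inE rooted_isoE; apply/andP/imsetP.
    by case=> _ /existsP[phi /eqP->]; exists phi; rewrite ?inE.
  by case=> phi _ ->; rewrite relabel_mem; split=> //; apply/existsP; exists phi.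
rewrite card_imset; last exact: relabel_inj tD.
by rewrite cardsT; exact: (card_Sn e.*2).
Qed.

End Classes.

(** * Cutting one cycle into two *)

Section SplitCycle.

Variables (H : finType) (h h' : H).
Hypothesis hh' : h != h'.
Implicit Types (s : {perm H}) (p : nat).

(** If [s] fixes [h'], the cycle [(h a_1 ... a_m)] of [s] becomes the two cycles
    [(h a_1 ... a_p)] and [(h' a_(p+1) ... a_m)]: the first transposition inserts
    [h'] before the cut point, the second one separates [h] from [h']. *)
Definition split_cycle p s : {perm H} :=
  (s * tperm h' ((s ^+ p.+1) h) * tperm h h')%g.

Lemma split_cycle_cut_point p s :
    s h' = h' -> let y := (s ^+ p.+1)%g h in
  [/\ porbit s y = porbit s h, h' \notin porbit s y
    & porbit (s * tperm h' y)%g h' = h' |: porbit s h].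
Proof.
move=> sh' y; have yh : porbit s y = porbit s h by rewrite porbit_perm.
have h'y : h' \notin porbit s y by rewrite yh porbit_sym (porbit_fix sh') inE.
by split=> //; rewrite porbit_mul_tperm_merge // (porbit_fix sh') yh.
Qed.

Lemma porbit_split_cycle_sep p s :
  s h' = h' -> h \notin porbit (split_cycle p s) h'.
Proof.
move=> sh'; rewrite mem_porbit_mul_tperm // negbK.
by have [_ _ ->] := split_cycle_cut_point p sh'; rewrite !inE porbit_id orbT.
Qed.

Lemma porbit_split_cycleU p s : s h' = h' ->
  porbit (split_cycle p s) h :|: porbit (split_cycle p s) h' = h' |: porbit s h.
Proof.
move=> sh'; have sep := porbit_split_cycle_sep p sh'.
have [_ _ <-] := split_cycle_cut_point p sh'.
rewrite -porbit_mul_tperm_merge // -mulgA tperm2 mulg1.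
apply/eqP; rewrite eq_porbit_mem.
by have [_ _ ->] := split_cycle_cut_point p sh'; rewrite !inE porbit_id orbT.
Qed.

Lemma porbit_split_cycle_out p s z : s h' = h' -> z != h' ->
  z \notin porbit s h -> porbit (split_cycle p s) z = porbit s z.
Proof.
move=> sh' zh' zh; have [yh _ _] := split_cycle_cut_point p sh'.
have h'z : h' \notin porbit s z by rewrite porbit_sym (porbit_fix sh') inE.
have yz : (s ^+ p.+1)%g h \notin porbit s z by rewrite porbit_sym yh.
have E : porbit (s * tperm h' ((s ^+ p.+1) h))%g z = porbit s z.
  exact: porbit_mul_tperm_out.
by rewrite porbit_mul_tperm_out E // porbit_sym.
Qed.

Lemma card_porbits_split_cycle p s :
  s h' = h' -> #|porbits (split_cycle p s)| = #|porbits s|.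
Proof.
move=> sh'; have [yh h'y E] := split_cycle_cut_point p sh'.
have := card_porbits_mul_tperm s h' ((s ^+ p.+1)%g h); rewrite h'y.
have -> /= : h' != (s ^+ p.+1)%g h.
  by apply: contraNneq h'y => ->; apply: porbit_id.
have := card_porbits_mul_tperm (s * tperm h' ((s ^+ p.+1) h))%g h h'.
rewrite E !inE porbit_id orbT hh' /= -/(split_cycle p s).
by do 3!move: #|_|; move=> a b c; lia.
Qed.

Lemma split_cycle_iter p s k : s h' = h' -> p < #|porbit s h| -> k <= p ->
  (split_cycle p s ^+ k)%g h = (s ^+ k)%g h.
Proof.
move=> sh' lt_p; have [yh h'y _] := split_cycle_cut_point p sh'.
elim: k => [|k IHk] lt_k; first by rewrite !perm1.
rewrite expgSr permM IHk 1?ltnW // /split_cycle !permM.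
have -> : s ((s ^+ k)%g h) = (s ^+ k.+1)%g h by rewrite expgSr permM.
have ne_h : (s ^+ k.+1)%g h != h.
  apply/eqP => E; suff : k.+1 = 0 by [].
  by apply: (expg_porbit_inj (s := s) (x := h)); rewrite ?perm1 ?E //; lia.
have ne_h' : (s ^+ k.+1)%g h != h'.
  by apply: contraNneq h'y => <-; rewrite yh mem_porbit.
have ne_y : (s ^+ k.+1)%g h != (s ^+ p.+1)%g h.
  apply/eqP; rewrite [in RHS]expgSr [in LHS]expgSr !permM => /perm_inj E.
  suff : k = p by lia.
  by apply: (expg_porbit_inj (s := s) (x := h)); rewrite ?E //; lia.
by rewrite (tpermD (x := h')) 1?eq_sym // tpermD // eq_sym.
Qed.

Lemma card_porbit_split_cycle p s :
  s h' = h' -> p < #|porbit s h| -> #|porbit (split_cycle p s) h| = p.+1.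
Proof.
move=> sh' lt_p; apply: card_porbit_first_return => // [|k /andP[k0 kp]].
  rewrite expgSr permM split_cycle_iter // /split_cycle !permM.
  have -> : s ((s ^+ p)%g h) = (s ^+ p.+1)%g h by rewrite expgSr permM.
  by rewrite tpermR tpermR.
rewrite split_cycle_iter //; apply/eqP => E.
suff : k = 0 by lia.
by apply: (expg_porbit_inj (s := s) (x := h)); rewrite ?perm1 ?E //; lia.
Qed.

(** Merging the cycles of [h] and [h'] and then taking [h'] out inverts the cut. *)
Lemma split_cycle_surj p s :
    h' \notin porbit s h -> #|porbit s h| = p.+1 ->
  exists s1, [/\ s1 h' = h', p < #|porbit s1 h| & s = split_cycle p s1].
Proof.
move=> sep card_h; pose s2 := (s * tperm h h')%g; pose y := s2 h'.
pose s1 := (s2 * tperm h' y)%g; exists s1.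
have s1h' : s1 h' = h' by rewrite /s1 permM tpermR.
have ne_h k : 0 < k <= p -> (s ^+ k)%g h != h.
  move=> kp; apply/eqP => E; suff : k = 0 by lia.
  by apply: (expg_porbit_inj (s := s) (x := h)); rewrite ?perm1 ?E ?card_h //; lia.
have s_not_h' k : (s ^+ k)%g h != h'.
  by apply: contraNneq sep => <-; apply: mem_porbit.
have y_out k : 0 < k <= p -> (s ^+ k)%g h != y.
  move=> kp; rewrite /y /s2 permM; case: tpermP => [_|E|_ _]; last 2 first.
  - exact: ne_h.
  - apply: contraNneq sep => E; rewrite -(porbit_stable s h) -E.
    exact: mem_porbit.
  exact: s_not_h'.
have iter_s1 k : k <= p -> (s1 ^+ k)%g h = (s ^+ k)%g h.
  elim: k => [|k IHk] kp; first by rewrite !perm1.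
  rewrite expgSr permM IHk 1?ltnW // !permM.
  have -> : s ((s ^+ k)%g h) = (s ^+ k.+1)%g h by rewrite expgSr permM.
  rewrite [tperm h h' _]tpermD 1?eq_sym ?ne_h ?s_not_h' //.
  by rewrite tpermD // 1?eq_sym ?y_out ?s_not_h'.
have s1y : (s1 ^+ p.+1)%g h = y.
  rewrite expgSr permM iter_s1 // !permM.
  have -> : s ((s ^+ p)%g h) = h.
    by rewrite -[RHS](iter_porbit s) card_h -permX expgSr permM.
  by rewrite tpermL tpermL.
split=> //; last by rewrite /split_cycle s1y /s1 -(mulgA _ _ (tperm h' y)) tperm2 mulg1
  -mulgA tperm2 mulg1.
rewrite ltnNge; apply/negP => le_p.
have : (s1 ^+ #|porbit s1 h|)%g h = h by rewrite permX iter_porbit.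
rewrite iter_s1 // => /eqP; apply/negP/ne_h.
by rewrite le_p lt0n card_porbit_neq0.
Qed.

Lemma split_cycleK p s : s h' = h' ->
  let s2 := (split_cycle p s * tperm h h')%g in (s2 * tperm h' (s2 h'))%g = s.
Proof.
move=> sh' s2; have -> : s2 = (s * tperm h' ((s ^+ p.+1) h))%g.
  by rewrite /s2 /split_cycle -mulgA tperm2 mulg1.
by rewrite permM sh' tpermL -mulgA tperm2 mulg1.
Qed.

End SplitCycle.

(** * Contracting an edge *)

Section Expand.

Variables (K H : finType) (f : K -> H) (h h' : H).
Hypothesis f_inj : injective f.
Hypothesis hh' : h != h'.
Hypothesis fh : forall y, f y != h.
Hypothesis fh' : forall y, f y != h'.
Hypothesis cover : forall x, [\/ x = h, x = h' | exists y, x = f y].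
Implicit Types (s a : {perm K}) (sigma alpha : {perm H}).

Lemma pick_f (T : Type) (g : K -> T) (d : T) y :
  (if [pick z | f z == f y] is Some z then g z else d) = g y.
Proof.
by case: pickP => [z /eqP/f_inj->|/(_ y)]; rewrite ?eqxx.
Qed.

Lemma pick_out (T : Type) (g : K -> T) (d : T) x :
  (forall y, f y != x) -> (if [pick z | f z == x] is Some z then g z else d) = d.
Proof. by move=> fx; case: pickP => // z; rewrite (negPf (fx z)). Qed.

Definition ext_fun s x := if [pick y | f y == x] is Some y then f (s y) else x.

Lemma ext_fun_inj s : injective (ext_fun s).
Proof.
have sf y : ext_fun s (f y) = f (s y) by rewrite /ext_fun pick_f.
have sh : ext_fun s h = h by rewrite /ext_fun pick_out.
have sh' : ext_fun s h' = h' by rewrite /ext_fun pick_out.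
move=> x y; case: (cover x) (cover y) => [->|->|[u ->]] [->|->|[v ->]];
  rewrite ?sf ?sh ?sh' //; move=> E.
- by have := fh (s v); rewrite E eqxx.
- by have := fh' (s v); rewrite E eqxx.
- by have := fh (s u); rewrite E eqxx.
- by have := fh' (s u); rewrite E eqxx.
- by move/f_inj/perm_inj: E => ->.
Qed.

Definition ext s : {perm H} := perm (@ext_fun_inj s).

Lemma ext_f s y : ext s (f y) = f (s y).
Proof. by rewrite permE /ext_fun pick_f. Qed.

Lemma ext_h s : ext s h = h.
Proof. by rewrite permE /ext_fun pick_out. Qed.

Lemma ext_h' s : ext s h' = h'.
Proof. by rewrite permE /ext_fun pick_out. Qed.

Lemma ext_inj : injective ext.
Proof.
by move=> s t E; apply/permP=> y; apply: f_inj; rewrite -!ext_f E.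
Qed.

Lemma ext_surj sigma : sigma h = h -> sigma h' = h' -> exists s, sigma = ext s.
Proof.
move=> sh sh'; pose g y := if [pick z | f z == sigma (f y)] is Some z then z else y.
have fg y : f (g y) = sigma (f y).
  rewrite /g; case: (cover (sigma (f y))) => [E|E|[z ->]].
  - by have := fh y; rewrite -(inj_eq (@perm_inj _ sigma)) E sh eqxx.
  - by have := fh' y; rewrite -(inj_eq (@perm_inj _ sigma)) E sh' eqxx.
  by rewrite (pick_f id).
have g_inj : injective g.
  by move=> y z E; apply/f_inj/(@perm_inj _ sigma); rewrite -!fg E.
exists (perm g_inj); apply/permP => x.
by case: (cover x) => [->|->|[y ->]]; rewrite ?sh ?sh' ?ext_h ?ext_h' // ext_f permE fg.
Qed.

Lemma porbit_ext s y : porbit (ext s) (f y) = f @: porbit s y.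
Proof. by apply: porbit_intertwine => z; rewrite ext_f. Qed.

Lemma card_porbits_ext s : #|porbits (ext s)| = #|porbits s| + 2.
Proof.
have E : porbits (ext s)
    = [set h] |: ([set h'] |: (fun A : {set K} => f @: A) @: porbits s).
  apply/setP=> A; rewrite !inE; apply/imsetP/or3P.
    case=> x _ ->; case: (cover x) => [->|->|[y ->]].
    - by rewrite porbit_fix ?ext_h // eqxx; constructor 1.
    - by rewrite porbit_fix ?ext_h' // eqxx; constructor 2.
    - by rewrite porbit_ext; constructor 3; do 2!apply: imset_f.
  case=> [/eqP->|/eqP->|/imsetP[_ /imsetP[y _ ->] ->]].
  - by exists h; rewrite ?porbit_fix ?ext_h.
  - by exists h'; rewrite ?porbit_fix ?ext_h'.
  - by exists (f y); rewrite ?porbit_ext.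
have out (x : H) : (forall y, f y != x) ->
    [set x] \notin (fun A : {set K} => f @: A) @: porbits s.
  move=> fx; apply/imsetP => -[_ /imsetP[y _ ->] /setP/(_ (f y))].
  by rewrite inE (negPf (fx y)) imset_f ?porbit_id.
rewrite E !cardsU1 !inE (negPf (out h fh)) (negPf (out h' fh')).
rewrite (inj_eq set1_inj) (negPf hh') /= card_imset; last exact: imset_inj.
by rewrite addnA addnC.
Qed.

Lemma card_cover : #|H| = #|K| + 2.
Proof.
have E : [set: H] = h |: (h' |: [set f y | y in [set: K]]).
  apply/setP=> x; rewrite !inE; case: (cover x) => [->|->|[y ->]];
    rewrite ?eqxx ?orbT //.
  by rewrite imset_f ?inE ?orbT.
have out (x : H) : (forall y, f y != x) -> x \notin [set f y | y in [set: K]].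
  by move=> fx; apply/imsetP => -[y _ E1]; have := fx y; rewrite E1 eqxx.
rewrite -cardsT E !cardsU1 !inE (negPf (out h fh)) (negPf (out h' fh')) (negPf hh').
by rewrite card_imset // cardsT /= addnA addnC.
Qed.

Definition expand_edge a : {perm H} := (ext a * tperm h h')%g.

(** Inserting [h] before [f x] and cutting the resulting cycle turns the vertex
    of [x] into the two end vertices of a new edge [{h, h'}], so that the [p]
    half-edges from [x] on follow [h] and the others follow [h']. *)
Definition insert_root s x : {perm H} := (ext s * tperm h (f x))%g.

Definition expand_vertex p s x : {perm H} := split_cycle h h' p (insert_root s x).

Lemma expand_edge_h a : expand_edge a h = h'.
Proof. by rewrite permM ext_h tpermL. Qed.

Lemma expand_edge_h' a : expand_edge a h' = h.
Proof. by rewrite permM ext_h' tpermR. Qed.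

Lemma expand_edge_f a y : expand_edge a (f y) = f (a y).
Proof. by rewrite permM ext_f tpermD // eq_sym. Qed.

Lemma insert_root_h' s x : insert_root s x h' = h'.
Proof. by rewrite permM ext_h' tpermD. Qed.

Lemma insert_root_h s x : insert_root s x h = f x.
Proof. by rewrite permM ext_h tpermL. Qed.

Lemma porbit_ext_h s x : h \notin porbit (ext s) (f x).
Proof.
by rewrite porbit_sym (porbit_fix (ext_h s)) inE.
Qed.

Lemma porbit_insert_root s x : porbit (insert_root s x) h = h |: f @: porbit s x.
Proof.
by rewrite porbit_mul_tperm_merge ?porbit_ext_h // porbit_ext (porbit_fix (ext_h s)).
Qed.

Lemma card_porbit_insert_root s x :
  #|porbit (insert_root s x) h| = #|porbit s x|.+1.
Proof.
rewrite porbit_insert_root cardsU1 card_imset //.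
by case: imsetP => // -[y _ E]; have := fh y; rewrite -E eqxx.
Qed.

Lemma expand_vertex_sep p s x : h \notin porbit (expand_vertex p s x) h'.
Proof. exact: porbit_split_cycle_sep (insert_root_h' s x). Qed.

Lemma expand_vertexU p s x :
  porbit (expand_vertex p s x) h :|: porbit (expand_vertex p s x) h'
    = h |: (h' |: f @: porbit s x).
Proof.
by rewrite porbit_split_cycleU ?insert_root_h' // porbit_insert_root setUCA.
Qed.

Lemma card_expand_vertex_h p s x : p <= #|porbit s x| ->
  #|porbit (expand_vertex p s x) h| = p.+1.
Proof.
move=> le_p; apply: card_porbit_split_cycle; rewrite ?insert_root_h' //.
by rewrite card_porbit_insert_root.
Qed.

Lemma card_expand_vertex_h' p s x : p <= #|porbit s x| ->
  #|porbit (expand_vertex p s x) h'| + p = #|porbit s x|.+1.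
Proof.
move=> le_p; have := congr1 (fun A : {set H} => #|A|) (expand_vertexU p s x).
rewrite cardsU !cardsU1 card_imset // disjoint_setI0 ?cards0; last first.
  apply/pred0P => z /=; apply/andP => -[zh zh'].
  have := expand_vertex_sep p s x; rewrite -eq_porbit_mem.
  by rewrite -!eq_porbit_mem in zh zh'; rewrite -(eqP zh) zh'.
have fN (u : H) : (forall y, f y != u) -> u \notin f @: porbit s x.
  by move=> fu; apply/imsetP => -[y _ E]; have := fu y; rewrite -E eqxx.
rewrite card_expand_vertex_h // !inE (negPf hh').
rewrite (negPf (fN h fh)) (negPf (fN h' fh')) /=.
by do 2!move: #|_|; lia.
Qed.

Lemma porbit_expand_vertex_out p s x y :
  y \notin porbit s x -> porbit (expand_vertex p s x) (f y) = f @: porbit s y.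
Proof.
move=> yx; have fyx : f y \notin porbit (insert_root s x) h.
  by rewrite porbit_insert_root !inE negb_or fh mem_imset.
rewrite porbit_split_cycle_out ?insert_root_h' // -porbit_ext.
apply: porbit_mul_tperm_out; first exact: porbit_ext_h.
by rewrite porbit_ext mem_imset // porbit_sym.
Qed.

(** The construction can be undone from the result alone: merging the cycles of
    [h] and [h'] and removing [h'], then [h], which is followed by [f x]. *)
Lemma expand_vertex_inj p s t x y :
  expand_vertex p s x = expand_vertex p t y -> s = t /\ x = y.
Proof.
move=> E; have Er : insert_root s x = insert_root t y.
  rewrite -(split_cycleK h p (insert_root_h' s x)).
  by rewrite -[RHS](split_cycleK h p (insert_root_h' t y)) -/(expand_vertex p _ _) E.
have xy : x = y by apply: f_inj; rewrite -(insert_root_h s) Er insert_root_h.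
by split=> //; apply: ext_inj; apply: (mulIg (tperm h (f x))); rewrite {2}xy.
Qed.

Lemma matching_expand_edge a : matching (expand_edge a) <-> matching a.
Proof.
split=> ma x.
  have [] := ma (f x); rewrite !expand_edge_f (inj_eq f_inj) => /f_inj-> ->.
  by [].
case: (cover x) => [->|->|[y ->]].
- by rewrite expand_edge_h expand_edge_h' eq_sym.
- by rewrite expand_edge_h' expand_edge_h.
- by rewrite !expand_edge_f (inj_eq f_inj); have [-> ->] := ma y.
Qed.

Lemma card_porbits_expand_vertex p s x :
  #|porbits (expand_vertex p s x)| = #|porbits s|.+1.
Proof.
rewrite card_porbits_split_cycle ?insert_root_h' //.
have := card_porbits_mul_tperm (ext s) h (f x).
rewrite card_porbits_ext porbit_ext_h (eq_sym h) fh /= -/(insert_root s x).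
by do 2!move: #|_|; lia.
Qed.

(** Stable sets are constant along [h], [h'] and [f x], and otherwise the two
    pairs of permutations have the same stable sets. *)
Lemma joined_expand p a s x :
  joined (expand_edge a) (expand_vertex p s x) <-> joined a s.
Proof.
have stableM sigma A u v : stable (sigma * tperm u v)%g A ->
    (u \in A) = (v \in A) -> stable sigma A.
  by move=> sA uv; rewrite -[sigma](mulgK (tperm u v)) tpermV; apply: stable_mul_tperm.
split=> jo A aA sA.
  pose B := [set z | if [pick y | f y == z] is Some y then y \in A else x \in A].
  have Bf y : (f y \in B) = (y \in A) by rewrite inE (pick_f (mem A)).
  have Bh : (h \in B) = (x \in A) by rewrite inE pick_out.
  have Bh' : (h' \in B) = (x \in A) by rewrite inE pick_out.
  move=> y z yA; rewrite -Bf; apply: (jo B) (f y) (f z) _; rewrite ?Bf //.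
    move=> u; case: (cover u) => [->|->|[v ->]].
    - by rewrite expand_edge_h Bh Bh'.
    - by rewrite expand_edge_h' Bh Bh'.
    - by rewrite expand_edge_f !Bf.
  have rB : stable (insert_root s x) B.
    apply: stable_mul_tperm; rewrite ?Bf ?Bh // => u.
    by case: (cover u) => [->|->|[v ->]]; rewrite ?ext_h ?ext_h' ?ext_f ?Bf.
  apply: stable_mul_tperm; rewrite ?Bh ?Bh' //; apply: stable_mul_tperm => //.
  by rewrite stable_iter // Bh Bh'.
have hA : (h \in A) = (h' \in A) by rewrite -(aA h) expand_edge_h.
have cA : stable (insert_root s x * tperm h' ((insert_root s x ^+ p.+1) h))%g A.
  exact: stableM sA hA.
have rA : stable (insert_root s x) A.
  by apply: (stableM _ _ _ _ cA); rewrite -[in LHS](cA h') permM insert_root_h' tpermL.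
have hx : (h \in A) = (f x \in A) by rewrite -(rA h) insert_root_h.
have eA : stable (ext s) A by apply: stableM rA hx.
have joA : forall y z, f y \in A -> f z \in A.
  move=> y z; have := jo (f @^-1: A) _ _ y z; rewrite !inE; apply.
    by move=> u; rewrite !inE -expand_edge_f aA.
  by move=> u; rewrite !inE -ext_f eA.
move=> u v; case: (cover u) (cover v) => [->|->|[y ->]] [->|->|[z ->]];
  rewrite -?hA ?hx //; exact: joA.
Qed.

(** Expanding or contracting an edge changes the numbers of vertices and of edges
    by one and does not affect connectedness. *)
Lemma plane_tree_expand e p a s x :
  plane_tree e.+1 (expand_edge a) (expand_vertex p s x) = plane_tree e a s.
Proof.
apply/plane_treeP/plane_treeP; rewrite card_cover card_porbits_expand_vertex.
  case=> cH /matching_expand_edge ma /joined_expand jo [cs]; split=> //.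
  by move: cH; rewrite doubleS addn2 => -[].
case=> cH /matching_expand_edge ma /joined_expand jo cs.
by split; rewrite ?cH ?cs ?addn2 //; apply: jo.
Qed.

Lemma expand_surj e p alpha sigma :
    plane_tree e.+1 alpha sigma -> 0 < e -> alpha h = h' ->
    h' \notin porbit sigma h -> #|porbit sigma h| = p.+1 ->
  exists a s x, [/\ alpha = expand_edge a, sigma = expand_vertex p s x
                  & p <= #|porbit s x|].
Proof.
case/plane_treeP=> cH ma jo _ e0 ah sep card_h.
have ah' : alpha h' = h by rewrite -ah; have [] := ma h.
have [s1 [s1h' lt_p Es]] := split_cycle_surj hh' sep card_h.
have [a Ea] : exists a, (alpha * tperm h h')%g = ext a.
  by apply: ext_surj; rewrite permM ?ah ?ah' ?tpermL ?tpermR.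
have Ealpha : alpha = expand_edge a.
  by rewrite /expand_edge -Ea -mulgA tperm2 mulg1.
(* If [s1] fixed [h], the edge [{h, h'}] would be a connected component. *)
have s1h : s1 h != h.
  apply/eqP => s1h.
  have stA : stable s1 [set h; h'].
    move=> z; rewrite !inE -{1}s1h -{1}s1h'.
    by rewrite !(inj_eq perm_inj).
  have [y _] : exists y : K, true.
    have : 0 < #|K| by move: cH; rewrite card_cover; lia.
    by case/card_gt0P=> y _; exists y.
  suff : f y \in [set h; h'] by rewrite !inE (negPf (fh y)) (negPf (fh' y)).
  apply: (jo _ _ _ h); rewrite ?set21 //.
    move=> z; rewrite !inE -{1}ah' (inj_eq perm_inj) orbC.
    by rewrite -{1}ah (inj_eq perm_inj).
  rewrite Es; apply: stable_mul_tperm; last by rewrite set21 set22.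
  by apply: stable_mul_tperm; rewrite // stable_iter // set21 set22.
have s1h'N : s1 h != h' 
  by apply: contraNneq hh' => E; apply/eqP/(@perm_inj _ s1); rewrite E s1h'.
have [x Ex] : exists x, s1 h = f x.
  by case: (cover (s1 h)) s1h s1h'N => [->|->|]; rewrite ?eqxx.
have [s Ess] : exists s, (s1 * tperm h (f x))%g = ext s.
  by apply: ext_surj; rewrite permM ?s1h' ?Ex ?tpermR ?tpermD.
have E1 : s1 = insert_root s x by rewrite /insert_root -Ess -mulgA tperm2 mulg1.
exists a, s, x; split; rewrite // ?Es ?E1 //.
by rewrite -ltnS -card_porbit_insert_root -E1.
Qed.

End Expand.

(** * Placing roots before and after a contraction *)

Section RootPlacements.

Variables (H : finType) (n : nat).
Implicit Types (s : {perm H}) (x : H) (d : 'I_n -> nat) (r : {ffun 'I_n -> H}).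

Definition roots_ok s d r : bool :=
  injectiveb (fun k => porbit s (r k)) && [forall k, #|porbit s (r k)| == d k].

Lemma roots_okP s d r :
  reflect ((forall k l, r k \in porbit s (r l) -> k = l)
           /\ (forall k, #|porbit s (r k)| = d k))
          (roots_ok s d r).
Proof.
apply: (iffP andP) => [[/injectiveP inj /forallP dr]|[inj dr]].
  split=> [k l|k]; last exact/eqP.
  by rewrite -eq_porbit_mem => /eqP/inj.
split; last by apply/forallP=> k; rewrite dr.
by apply/injectiveP => k l /eqP; rewrite eq_porbit_mem => /inj.
Qed.

Arguments roots_okP {s d r}.

Definition roots_off s x d : {set {ffun 'I_n -> H}} :=
  [set r | roots_ok s d r && [forall k, x \notin porbit s (r k)]].

Definition roots_at s x i d : {set {ffun 'I_n -> H}} :=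
  [set r | roots_ok s d r && (r i == x)].

Definition set_degree d i v : 'I_n -> nat := fun k => if k == i then v else d k.

Lemma sum_card_setI (T : finType) (A : {set T}) (P : pred T) :
  \sum_(r in A) P r = #|[set r in A | P r]|.
Proof.
rewrite -sum1_card big_mkcond [RHS]big_mkcond; apply: eq_bigr => r _.
by rewrite inE; case: (r \in A) => //=; case: (P r).
Qed.

(** At most one root vertex can be the vertex of [y]. *)
Lemma roots_off_split s x y d :
  #|roots_off s x d|
    = #|[set r in roots_off s x d | [forall k, y \notin porbit s (r k)]]|
      + \sum_(i < n) #|[set r in roots_off s x d | y \in porbit s (r i)]|.
Proof.
under eq_bigr => i _
  do rewrite -(sum_card_setI _ (fun r : {ffun 'I_n -> H} => y \in porbit s (r i))).
rewrite exchange_big -sum_card_setI -big_split -sum1_card /=.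
apply: eq_bigr => r.
rewrite inE => /andP[ok _]; have [inj _] := roots_okP ok.
have [/forallP yN|] := boolP [forall k, y \notin porbit s (r k)].
  by rewrite big1 // => i _; rewrite (negPf (yN i)).
rewrite negb_forall => /existsP[i]; rewrite negbK => yi.
rewrite (bigD1 i) //= yi big1 // => k ki; apply/eqP; rewrite eqb0.
apply: contraNN ki => yk; apply/eqP/inj; rewrite porbit_sym.
rewrite -eq_porbit_mem in yi; rewrite -eq_porbit_mem in yk.
by rewrite -eq_porbit_mem -(eqP yi) (eqP yk).
Qed.

End RootPlacements.

Arguments roots_okP {H n s d r}.

Section ExpandRoots.

Variables (K H : finType) (f : K -> H) (h h' : H).
Hypothesis f_inj : injective f.
Hypothesis hh' : h != h'.
Hypothesis fh : forall y, f y != h.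
Hypothesis fh' : forall y, f y != h'.
Hypothesis cover : forall x, [\/ x = h, x = h' | exists y, x = f y].
Variables (n p : nat) (s : {perm K}) (x : K).
Hypothesis le_p : p <= #|porbit s x|.

Let sigma := expand_vertex f_inj fh fh' cover p s x.

Let h_sep : h \notin porbit sigma h'.
Proof. exact: expand_vertex_sep. Qed.

Let porbit_out y : y \notin porbit s x -> porbit sigma (f y) = f @: porbit s y.
Proof. exact: porbit_expand_vertex_out. Qed.

Let h_out y : h \notin f @: porbit s y.
Proof. by apply/imsetP => -[z _ E]; have := fh z; rewrite -E eqxx. Qed.

Let h'_out y : h' \notin f @: porbit s y.
Proof. by apply/imsetP => -[z _ E]; have := fh' z; rewrite -E eqxx. Qed.

Let lift_out z : h \notin porbit sigma z -> h' \notin porbit sigma z ->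
  exists y, z = f y /\ y \notin porbit s x.
Proof.
move=> hz h'z; case: (cover z) hz h'z => [->|->|[y ->]]; rewrite ?porbit_id //.
move=> hz h'z; exists y; split=> //; apply/negP => yx.
have : f y \in porbit sigma h :|: porbit sigma h'.
  by rewrite expand_vertexU // !inE imset_f ?orbT.
by rewrite inE ![f y \in _]porbit_sym (negPf hz) (negPf h'z).
Qed.

(** Away from the merged vertex the cycles do not change, so roots off both ends
    of the new edge are roots off the merged vertex. *)
Lemma card_roots_off_expand_off (d : 'I_n -> nat) :
  #|[set r in roots_off sigma h d | [forall k, h' \notin porbit sigma (r k)]]|
    = #|roots_off s x d|.
Proof.
pose F (r : {ffun 'I_n -> K}) : {ffun 'I_n -> H} := [ffun k => f (r k)].
have F_inj : injective F.
  by move=> r t /ffunP E; apply/ffunP=> k; have := E k; rewrite !ffunE => /f_inj.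
rewrite -(card_imset _ F_inj); apply: eq_card => r; apply/idP/imsetP.
  rewrite !inE => /andP[/andP[/roots_okP[inj dr] /forallP hr] /forallP h'r].
  have [r' Er] := fin_all_exists (fun k => lift_out (hr k) (h'r k)).
  exists (finfun r'); last by apply/ffunP=> k; rewrite !ffunE; have [] := Er k.
  rewrite inE; apply/andP; split; last first.
    by apply/forallP=> k; rewrite ffunE porbit_sym; have [] := Er k.
  have porb k : porbit sigma (r k) = f @: porbit s (r' k).
    by have [-> /porbit_out] := Er k.
  apply/roots_okP; split=> [k l|k]; rewrite !ffunE; last first.
    by rewrite -dr porb card_imset.
  move=> kl; apply: inj; rewrite porb; have [-> _] := Er k.
  exact: imset_f.
case=> r' + ->; rewrite !inE => /andP[/roots_okP[inj dr] /forallP xr].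
have porb k : porbit sigma (f (r' k)) = f @: porbit s (r' k).
  by rewrite porbit_out // porbit_sym.
rewrite -andbA; apply/and3P; split; last 2 first.
- by apply/forallP=> k; rewrite ffunE porb.
- by apply/forallP=> k; rewrite ffunE porb.
apply/roots_okP; split=> [k l|k]; rewrite !ffunE porb; last by rewrite card_imset.
by rewrite mem_imset // => /inj.
Qed.

(** Here root [i] may be any of the [d i] half-edges at the end [h'] of the new
    edge. After the contraction that choice is forgotten, and the merged vertex
    is rooted at [x]. *)
Lemma card_roots_off_expand_at (d : 'I_n -> nat) i :
  #|[set r in roots_off sigma h d | h' \in porbit sigma (r i)]|
    = d i * #|roots_at s x i (set_degree d i (d i + p).-1)|.
Proof.
set d' := set_degree _ _ _; set B := [set r in _ | _].
have card_h' : #|porbit sigma h'| + p = #|porbit s x|.+1.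
  exact: card_expand_vertex_h'.
have B_card r : r \in B -> d i + p = #|porbit s x|.+1.
  rewrite !inE => /andP[/andP[/roots_okP[_ dr] _]].
  by rewrite -eq_porbit_mem -card_h' -dr => /eqP->.
have [E|NE] := eqVneq (d i + p) #|porbit s x|.+1; last first.
  rewrite (_ : B = set0); last first.
    by apply/setP=> r; rewrite [RHS]inE; apply: contra_neqF NE => /B_card.
  rewrite cards0; have [->//|d0] := posnP (d i).
  rewrite (_ : roots_at _ _ _ _ = set0) ?cards0 ?muln0 //; apply/setP=> r.
  rewrite !inE; apply: contra_neqF NE => /andP[/roots_okP[_ /(_ i)]].
  by rewrite /d' /set_degree eqxx => E /eqP <-; rewrite E; lia.
have d'i : d' i = #|porbit s x| by rewrite /d' /set_degree eqxx E.
have d'k k : k != i -> d' k = d k by rewrite /d' /set_degree => /negPf->.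
have di : #|porbit sigma h'| = d i by move: E; rewrite -card_h' => /addIn.
pose F (u : H * {ffun 'I_n -> K}) : {ffun 'I_n -> H} :=
  [ffun k => if k == i then u.1 else f (u.2 k)].
rewrite -di -cardsX -(card_in_imset (f := F)); last first.
  move=> [z r] [w t]; rewrite !inE /= => /andP[_ /andP[_ /eqP rx]].
  move=> /andP[_ /andP[_ /eqP tx]] /ffunP E1; congr (_, _).
    by have := E1 i; rewrite !ffunE eqxx.
  apply/ffunP=> k; have [->|ki] := eqVneq k i; first by rewrite rx tx.
  by have := E1 k; rewrite !ffunE (negPf ki) => /f_inj.
apply: eq_card => r; apply/idP/imsetP.
  rewrite !inE => /andP[/andP[/roots_okP[inj dr] /forallP hr] h'i].
  have h'r k : k != i -> h' \notin porbit sigma (r k).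
    apply: contraNN => h'k; apply/eqP/inj; rewrite porbit_sym.
    rewrite -eq_porbit_mem in h'i; rewrite -eq_porbit_mem in h'k.
    by rewrite -eq_porbit_mem -(eqP h'i) (eqP h'k).
  have ex k : exists y, k != i -> r k = f y /\ y \notin porbit s x.
    have [_|ki] := eqVneq k i; first by exists x.
    by have [y Ey] := lift_out (hr k) (h'r k ki); exists y.
  have [r' Er] := fin_all_exists ex.
  exists (r i, [ffun k => if k == i then x else r' k]); last first.
    apply/ffunP=> k; rewrite !ffunE /=; case: eqVneq => [->//|ki].
    by have [] := Er k ki.
  rewrite !inE /= porbit_sym h'i ffunE !eqxx andbT /=.
  have porb k : k != i -> porbit sigma (r k) = f @: porbit s (r' k).
    by move=> ki; have [-> /porbit_out] := Er k ki.
  apply/roots_okP; split=> [k l|k]; rewrite !ffunE; last first.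
    have [->|ki] := eqVneq k i; first by rewrite d'i.
    by rewrite d'k // -dr porb // card_imset.
  have [->|ki] := eqVneq k i; have [->//|li] := eqVneq l i.
  - by have [_ /negPf] := Er l li; rewrite porbit_sym => ->.
  - by have [_ /negPf->] := Er k ki.
  move=> kl; apply: inj; rewrite porb //; have [-> _] := Er k ki.
  exact: imset_f.
case=> -[z r'] + ->; rewrite !inE /= => /and3P[zh' /roots_okP[inj dr] /eqP rx].
have rk k : k != i -> r' k \notin porbit s x.
  by apply: contraNN => kx; apply/eqP/inj; rewrite rx.
have zorb : porbit sigma z = porbit sigma h' by apply/eqP; rewrite eq_porbit_mem.
have porb k : k != i -> porbit sigma (f (r' k)) = f @: porbit s (r' k).
  by move=> ki; rewrite porbit_out // rk.
rewrite !ffunE eqxx porbit_sym zh' andbT; apply/andP; split; last first.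
  apply/forallP=> k; rewrite ffunE; case: eqVneq => [_|ki]; last by rewrite porb.
  by rewrite zorb.
apply/roots_okP; split=> [k l|k]; rewrite !ffunE; last first.
  case: eqVneq => [->|ki]; first by rewrite zorb di.
  by rewrite porb // card_imset // dr d'k.
have [->|ki] := eqVneq k i; have [->//|li] := eqVneq l i.
- rewrite -eq_porbit_mem zorb eq_porbit_mem porb //.
  by rewrite (negPf (h'_out _)).
- rewrite porbit_sym -eq_porbit_mem zorb eq_porbit_mem porb //.
  by rewrite (negPf (h'_out _)).
by rewrite porb // mem_imset // => /inj.
Qed.

Lemma card_roots_off_expand (d : 'I_n -> nat) :
  #|roots_off sigma h d|
    = #|roots_off s x d|
      + \sum_(i < n) d i * #|roots_at s x i (set_degree d i (d i + p).-1)|.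
Proof.
rewrite (roots_off_split _ _ h') card_roots_off_expand_off; congr (_ + _).
by apply: eq_bigr => i _; apply: card_roots_off_expand_at.
Qed.

End ExpandRoots.

(** * The recursion for labelled trees *)

Lemma card_set_pair (A B : finType) (P : A -> pred B) :
  #|[set u : A * B | P u.1 u.2]| = \sum_(a : A) #|[set b | P a b]|.
Proof.
under eq_bigr => a _ do rewrite -sum1dep_card.
by rewrite -sum1dep_card pair_big_dep.
Qed.

Lemma card_set_bij (A B : finType) (F : A -> B) (P : pred B) :
  bijective F -> #|[set b | P b]| = #|[set a | P (F a)]|.
Proof.
move=> F_bij; rewrite -(on_card_preimset (onW_bij [set b | P b] F_bij)).
by apply: eq_card => a; rewrite !inE.
Qed.

Section RootTuples.

Variables (H : finType) (n : nat).
Implicit Types (s : {perm H}) (d : seq nat).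

Definition tuple_of_ffun (r : {ffun 'I_n -> H}) : n.-tuple H := [tuple r k | k < n].

Lemma tuple_of_ffun_bij : bijective tuple_of_ffun.
Proof.
exists (fun t : n.-tuple H => [ffun k => tnth t k]) => [r|t].
  by apply/ffunP=> k; rewrite ffunE tnth_mktuple.
by apply: eq_from_tnth => k; rewrite tnth_mktuple ffunE.
Qed.

Definition rcons_tuple_of_ffun (u : H * {ffun 'I_n -> H}) : n.+1.-tuple H :=
  rcons_tuple (tuple_of_ffun u.2) u.1.

Lemma rcons_tuple_of_ffun_bij : bijective rcons_tuple_of_ffun.
Proof.
apply: inj_card_bij; last by rewrite card_tuple card_prod card_ffun card_ord expnS.
move=> [x r] [y t] /(congr1 val) /= /rcons_inj[E ->]; congr (_, _).
by apply: (bij_inj tuple_of_ffun_bij); apply: val_inj; apply: E.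
Qed.

Lemma uniq_roots s (r : {ffun 'I_n -> H}) :
  uniq [seq porbit s x | x <- tuple_of_ffun r] = injectiveb (fun k => porbit s (r k)).
Proof. by rewrite /= -map_comp. Qed.

Lemma degrees_roots s (r : {ffun 'I_n -> H}) d : size d = n ->
  ([seq #|porbit s x| | x <- tuple_of_ffun r] == d)
    = [forall k, #|porbit s (r k)| == nth 0 d k].
Proof.
move=> sd; have E k : #|porbit s (r k)|
    = nth 0 [seq #|porbit s x| | x <- tuple_of_ffun r] k.
  have Et : tnth (tuple_of_ffun r) k = r k := tnth_mktuple r k.
  by rewrite (nth_map (r k)) ?size_tuple // -tnth_nth Et.
apply/eqP/forallP => [<- k|Ed]; first by rewrite E.
apply: (@eq_from_nth _ 0); rewrite size_map size_tuple // => k kn.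
by have := Ed (Ordinal kn); rewrite E => /eqP.
Qed.

Lemma card_root_tuples s d : size d = n ->
  #|[set r : n.-tuple H | uniq [seq porbit s x | x <- r]
       && ([seq #|porbit s x| | x <- take (size d) r] == d)]|
    = #|[set r : {ffun 'I_n -> H} | roots_ok s (nth 0 d) r]|.
Proof.
move=> sd; rewrite (card_set_bij _ tuple_of_ffun_bij).
apply: eq_card => r; rewrite !inE uniq_roots take_oversize ?size_tuple ?sd //.
by rewrite degrees_roots.
Qed.

Lemma uniq_rcons_roots s (r : {ffun 'I_n -> H}) x :
  uniq [seq porbit s y | y <- rcons (tuple_of_ffun r) x]
    = injectiveb (fun k => porbit s (r k)) && [forall k, x \notin porbit s (r k)].
Proof.
rewrite map_rcons rcons_uniq uniq_roots andbC; congr (_ && _).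
apply/idP/forallP => [/mapP N k|N]; last apply/mapP => -[y /codomP[k ->] E].
  apply/negP => xk; apply: N; exists (r k); first exact: codom_f.
  by apply/eqP; rewrite eq_porbit_mem.
by have := N k; rewrite -eq_porbit_mem E eqxx.
Qed.

Lemma card_root_tuples_rcons s d j : size d = n ->
  #|[set r : n.+1.-tuple H | uniq [seq porbit s x | x <- r]
       && ([seq #|porbit s x| | x <- take (size (rcons d j)) r] == rcons d j)]|
    = \sum_(x | #|porbit s x| == j) #|roots_off s x (fun k : 'I_n => nth 0 d k)|.
Proof.
move=> sd; rewrite (card_set_bij _ rcons_tuple_of_ffun_bij).
pose P x (r : {ffun 'I_n -> H}) :=
  uniq [seq porbit s y | y <- rcons (tuple_of_ffun r) x]
    && ([seq #|porbit s y| | y <- take (size (rcons d j)) (rcons (tuple_of_ffun r) x)]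
        == rcons d j).
transitivity (\sum_x #|[set r | P x r]|); first exact: (card_set_pair P).
rewrite [RHS]big_mkcond; apply: eq_bigr => x _.
transitivity #|[set r | (#|porbit s x| == j)
                        && (r \in roots_off s x (fun k : 'I_n => nth 0 d k))]|.
  apply: eq_card => r; rewrite !inE /P uniq_rcons_roots take_oversize; last first.
    by rewrite size_rcons size_tuple size_rcons sd.
  rewrite map_rcons eqseq_rcons degrees_roots //.
  by rewrite [_ && (_ == j)]andbC [RHS]andbCA /roots_ok -!andbA; do !bool_congr.
case: eqP => _; first by apply: eq_card => r; rewrite inE.
by apply: eq_card0 => r; rewrite inE.
Qed.

Lemma card_root_tuples_free s d : size d = n ->
  #|[set r : n.+1.-tuple H | uniq [seq porbit s x | x <- r]
       && ([seq #|porbit s x| | x <- take (size d) r] == d)]|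
    = \sum_x #|roots_off s x (fun k : 'I_n => nth 0 d k)|.
Proof.
move=> sd; rewrite (card_set_bij _ rcons_tuple_of_ffun_bij).
pose P x (r : {ffun 'I_n -> H}) :=
  uniq [seq porbit s y | y <- rcons (tuple_of_ffun r) x]
    && ([seq #|porbit s y| | y <- take (size (d)) (rcons (tuple_of_ffun r) x)]
        == d).
transitivity (\sum_x #|[set r | P x r]|); first exact: (card_set_pair P).
apply: eq_bigr => x _; apply: eq_card => r; rewrite !inE /P uniq_rcons_roots.
rewrite -cats1 takel_cat ?size_tuple ?sd // take_oversize ?size_tuple //.
by rewrite degrees_roots // /roots_ok -!andbA; do !bool_congr.
Qed.

End RootTuples.

Section TreeSums.

Variable n : nat.
Implicit Types (e j : nat) (d : seq nat).

Definition tree_pairs e : {set {perm 'I_e.*2} * {perm 'I_e.*2}} :=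
  [set t | plane_tree e t.1 t.2].

Lemma card_labelled_sum N e d :
  #|labelled_trees N e d|
    = \sum_(t in tree_pairs e)
        #|[set r : N.-tuple 'I_e.*2 | uniq [seq porbit t.2 x | x <- r]
            && ([seq #|porbit t.2 x| | x <- take (size d) r] == d)]|.
Proof.
pose Q (t : {perm 'I_e.*2} * {perm 'I_e.*2}) (r : N.-tuple 'I_e.*2) :=
  rooted_tree e (t, r) && degrees_spec d (t, r).
transitivity (\sum_t #|[set r | Q t r]|).
  by rewrite -card_set_pair; apply: eq_card => -[t r]; rewrite !inE.
rewrite [RHS]big_mkcond; apply: eq_bigr => -[a s] _; rewrite inE /=.
case: ifP => tr; first by apply: eq_card => r; rewrite !inE /Q /= tr.
by apply: eq_card0 => r; rewrite !inE /Q /= tr.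
Qed.

Lemma card_labelled_full e d : size d = n ->
  #|labelled_trees n e d|
    = \sum_(t in tree_pairs e)
        #|[set r : {ffun 'I_n -> 'I_e.*2} | roots_ok t.2 (nth 0 d) r]|.
Proof.
move=> sd; rewrite card_labelled_sum; apply: eq_bigr => t _.
exact: card_root_tuples.
Qed.

Lemma card_labelled_rcons e d j : size d = n ->
  #|labelled_trees n.+1 e (rcons d j)|
    = \sum_(t in tree_pairs e) \sum_(x | #|porbit t.2 x| == j)
        #|roots_off t.2 x (fun k : 'I_n => nth 0 d k)|.
Proof.
move=> sd; rewrite card_labelled_sum; apply: eq_bigr => t _.
exact: card_root_tuples_rcons.
Qed.

Lemma card_labelled_free e d : size d = n ->
  #|labelled_trees n.+1 e d|
    = \sum_(t in tree_pairs e) \sum_x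
        #|roots_off t.2 x (fun k : 'I_n => nth 0 d k)|.
Proof.
move=> sd; rewrite card_labelled_sum; apply: eq_bigr => t _.
exact: card_root_tuples_free.
Qed.

End TreeSums.

Lemma card_roots_offJ (H : finType) n (s phi : {perm H}) x (d : 'I_n -> nat) :
  #|roots_off (s ^ phi)%g (phi x) d| = #|roots_off s x d|.
Proof.
pose F (r : {ffun 'I_n -> H}) : {ffun 'I_n -> H} := [ffun k => phi (r k)].
have F_bij : bijective F.
  exists (fun r : {ffun 'I_n -> H} => [ffun k => phi^-1%g (r k)]) => r;
    by apply/ffunP=> k; rewrite !ffunE ?permK ?permKV.
rewrite {1}/roots_off (card_set_bij _ F_bij); apply: eq_card => r; rewrite !inE.
congr (_ && _); last first.
  apply: eq_forallb => k; rewrite ffunE -!eq_porbit_mem eq_porbitJ //.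
congr (_ && _); last by apply: eq_forallb => k; rewrite ffunE card_porbitJ.
apply/injectiveP/injectiveP => inj k l E; apply: inj.
  by rewrite !ffunE; apply/eqP; rewrite eq_porbitJ; apply/eqP.
by move/eqP: E; rewrite !ffunE eq_porbitJ => /eqP.
Qed.

Section MarkedEdge.

Variables (n e j : nat) (d : seq nat).
Hypothesis size_d : size d = n.
Notation H := 'I_e.*2.
Implicit Types x y : H.

(** The number of labelled trees in which the last root is [x] and the other
    half of its edge is [y]. *)
Definition marked_trees x y : nat :=
  \sum_(t in tree_pairs e | (t.1 x == y) && (#|porbit t.2 x| == j))
    #|roots_off t.2 x (fun k : 'I_n => nth 0 d k)|.

Lemma marked_treesJ (phi : {perm H}) x y :
  marked_trees (phi x) (phi y) = marked_trees x y.
Proof.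
pose J (t : {perm H} * {perm H}) := (t.1 ^ phi, t.2 ^ phi)%g.
have J_bij : bijective J.
  exists (fun t : {perm H} * {perm H} => (t.1 ^ phi^-1, t.2 ^ phi^-1)%g).
    by case=> a s; rewrite /J /= !conjgK.
  by case=> a s; rewrite /J /= !conjgKV.
rewrite /marked_trees (reindex J); last exact: onW_bij.
apply: eq_big => [[a s]|[a s] _] /=; last by rewrite card_roots_offJ.
by rewrite !inE /= plane_treeJ permJ (inj_eq perm_inj) card_porbitJ.
Qed.

Lemma marked_trees_const x y u v :
  x != y -> u != v -> marked_trees x y = marked_trees u v.
Proof.
move=> xy uv; pose phi := (tperm x u * tperm (tperm x u y) v)%g.
have ux : tperm x u y != u by rewrite -{2}(tpermL x u) (inj_eq perm_inj) eq_sym.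
rewrite -(marked_treesJ phi); congr marked_trees; rewrite /phi permM.
  by rewrite tpermL [LHS]tpermD 1?eq_sym // eq_sym.
by rewrite tpermL.
Qed.

(** By symmetry the number of trees with marked root edge [{x, y}] does not
    depend on the pair of distinct half-edges [x], [y]. *)
Lemma card_labelled_marked x y : x != y ->
  #|labelled_trees n.+1 e (rcons d j)| = e.*2 * e.*2.-1 * marked_trees x y.
Proof.
move=> xy; rewrite (card_labelled_rcons _ _ size_d).
transitivity (\sum_u \sum_v marked_trees u v).
  under eq_bigr => t _ do rewrite big_mkcond.
  rewrite exchange_big; apply: eq_bigr => u _.
  rewrite /marked_trees (exchange_big_dep (mem (tree_pairs e))) /=; last first.
    by move=> v t _ /andP[].
  apply: eq_bigr => t tr; case: ifP => deg.
    by rewrite (big_pred1 (t.1 u)) // => v; rewrite tr andbT /= eq_sym.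
  by rewrite big_pred0 // => v; rewrite !andbF.
transitivity (\sum_(u : H) \sum_(v | v != u) marked_trees x y).
  apply: eq_bigr => u _; rewrite (bigD1 u) //= [X in X + _]big1 ?add0n.
    by apply: eq_bigr => v vu; apply: marked_trees_const; rewrite // eq_sym.
  move=> [a s] /andP[]; rewrite inE => /plane_treeP[_ ma _ _] /=.
  by have [_ /negPf->] := ma u.
under eq_bigr => u _ do rewrite sum_nat_const cardC1.
by rewrite sum_nat_const !card_ord mulnA.
Qed.

End MarkedEdge.

Section ContractMarked.

Variables (e : nat) (f : 'I_e.*2 -> 'I_e.+1.*2) (h h' : 'I_e.+1.*2).
Hypothesis f_inj : injective f.
Hypothesis hh' : h != h'.
Hypothesis fh : forall y, f y != h.
Hypothesis fh' : forall y, f y != h'.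
Hypothesis cover : forall x, [\/ x = h, x = h' | exists y, x = f y].
Hypothesis e_gt0 : 0 < e.
Variables (n p : nat) (d : seq nat).

Lemma marked_trees_expand :
  marked_trees n p.+1 d h h'
    = \sum_(t in tree_pairs e) \sum_(x | p <= #|porbit t.2 x|)
        #|roots_off (expand_vertex f_inj fh fh' cover p t.2 x) h
            (fun k : 'I_n => nth 0 d k)|.
Proof.
pose F (u : {perm 'I_e.*2} * {perm 'I_e.*2} * 'I_e.*2) :=
  (expand_edge f_inj fh fh' cover u.1.1, expand_vertex f_inj fh fh' cover p u.1.2 u.2).
pose D := [set u : {perm 'I_e.*2} * {perm 'I_e.*2} * 'I_e.*2
            | (u.1 \in tree_pairs e) && (p <= #|porbit u.1.2 u.2|)].
have F_inj : injective F.
  move=> [[a s] x] [[b t] y] [/mulIg/ext_inj -> E].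
  by have [-> ->] := expand_vertex_inj hh' E.
rewrite pair_big_dep /= (eq_bigl (fun u => u \in D)); last first.
  by move=> u; rewrite [RHS]inE.
rewrite -(big_imset (h := F) (fun t => #|roots_off t.2 h (fun k : 'I_n => nth 0 d k)|));
  last exact: in2W.
apply: eq_bigl => -[alpha sigma] /=; apply/idP/imsetP.
  rewrite inE /= => /and3P[tr /eqP ah /eqP card_h].
  have sep : h' \notin porbit sigma h by rewrite -ah; apply: tree_no_loop tr.
  have [a [s [x [Ea Es le_p]]]] :=
    expand_surj f_inj hh' fh fh' cover tr e_gt0 ah sep card_h.
  exists (a, s, x); rewrite /F /= ?Ea ?Es // !inE /= le_p andbT.
  by rewrite -(plane_tree_expand f_inj hh' fh fh' cover e p a s x) -Ea -Es.
case=> -[[a s] x]; rewrite !inE /= => /andP[tr le_p] [-> ->].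
rewrite (plane_tree_expand _ hh') // tr expand_edge_h eqxx /=.
by rewrite card_expand_vertex_h.
Qed.

End ContractMarked.

Section LabelledRecursion.

Variables (n e p : nat) (d : seq nat).
Hypothesis size_d : size d = n.
Hypothesis e_gt0 : 0 < e.

Let f (y : 'I_e.*2) : 'I_e.+1.*2 := lift ord0 (lift ord0 y).
Let h : 'I_e.+1.*2 := @ord0 (e.*2).+1.
Let h' : 'I_e.+1.*2 := lift ord0 (@ord0 e.*2).

Let f_inj : injective f.
Proof. by move=> x y /lift_inj/lift_inj. Qed.
Let hh' : h != h'.
Proof. by []. Qed.
Let fh y : f y != h.
Proof. by []. Qed.
Let fh' y : f y != h'.
Proof. by []. Qed.
Let cover x : [\/ x = h, x = h' | exists y, x = f y].
Proof.
case: (@unliftP (e.*2).+2 ord0 x) => [y ->|->]; last by constructor 1.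
case: (unliftP ord0 y) => [z ->|->]; last by constructor 2.
by constructor 3; exists z.
Qed.

(** The other end of the marked root edge may be the root vertex with index [i],
    which gives the [i]th term of the sum, or no root vertex; then the merged
    vertex is a last root vertex of any degree at least [p], and the sum on the
    left supplies the trees in which its degree is less than [p]. *)
Lemma marked_trees_rec :
  marked_trees n p.+1 d h h'
      + \sum_(1 <= j < p) #|labelled_trees n.+1 e (rcons d j)|
    = \sum_(i < n) nth 0 d i
        * #|labelled_trees n e (set_nth 0 d i (nth 0 d i + p).-1)|
      + #|labelled_trees n.+1 e d|.
Proof.
pose dk (k : 'I_n) := nth 0 d k.
rewrite (marked_trees_expand f_inj hh' fh fh' cover) //.
have -> : \sum_(1 <= j < p) #|labelled_trees n.+1 e (rcons d j)|
    = \sum_(t in tree_pairs e) \sum_(x | ~~ (p <= #|porbit t.2 x|))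
        #|roots_off t.2 x dk|.
  under eq_bigr => j _ do rewrite (card_labelled_rcons _ _ size_d).
  rewrite exchange_big; apply: eq_bigr => t _.
  under eq_bigr => j _ do rewrite big_mkcond.
  rewrite exchange_big [RHS]big_mkcond; apply: eq_bigr => x _ /=.
  rewrite -big_mkcond /= -ltnNge.
  case: ltnP => lt_p.
    rewrite (big_rem #|porbit t.2 x|) /=; last first.
      by rewrite mem_index_iota lt_p lt0n card_porbit_neq0.
    rewrite eqxx big_seq_cond big1 ?addn0 // => j /andP[].
    by rewrite mem_rem_uniq ?iota_uniq // inE => /andP[/negPf]; rewrite eq_sym => ->.
  rewrite big_nat_cond big1 // => j /andP[/andP[_ jp] /eqP E].
  by move: lt_p; rewrite E leqNgt jp.
rewrite (card_labelled_free _ size_d) -big_split /=.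
pose at_ i (t : {perm 'I_e.*2} * {perm 'I_e.*2}) := \sum_(x | p <= #|porbit t.2 x|)
  #|roots_at t.2 x i (set_degree dk i (dk i + p).-1)|.
transitivity (\sum_(t in tree_pairs e)
    (\sum_(i < n) dk i * at_ i t + \sum_x #|roots_off t.2 x dk|)).
  apply: eq_bigr => t _; rewrite [in RHS](bigID (fun x => p <= #|porbit t.2 x|)) /=.
  rewrite addnA; congr (_ + _).
  rewrite (eq_bigr _ (fun x le_p =>
    card_roots_off_expand f_inj hh' fh fh' cover le_p dk)) big_split addnC.
  congr (_ + _); rewrite exchange_big /=; apply: eq_bigr => i _.
  by rewrite /at_ big_distrr.
rewrite big_split; congr (_ + _); rewrite exchange_big /=.
apply: eq_bigr => i _; rewrite -/(dk i).
(* When [d_i > 0] the new degree of root [i] is at least [p], so the condition on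
   the degree of [x] is automatic and the sum over [x] is over the root [i]. *)
have [->|di0] := posnP (dk i); first by rewrite mul0n big1.
rewrite (@card_labelled_full n); last by rewrite size_set_nth size_d; apply/maxn_idPr.
rewrite big_distrr; apply: eq_bigr => t _ /=; congr (_ * _).
rewrite -[RHS]sum1dep_card (partition_big (fun r : {ffun 'I_n -> 'I_e.*2} => r i)
  (fun x => p <= #|porbit t.2 x|)) /=; last first.
  move=> r /roots_okP[_ ->]; rewrite nth_set_nth /= eqxx.
  by move: di0; rewrite /dk; lia.
apply: eq_bigr => x _; rewrite sum1dep_card; apply: eq_card => r; rewrite !inE.
congr (_ && _); congr (_ && _); apply: eq_forallb => k.
by rewrite /set_degree nth_set_nth.
Qed.

End LabelledRecursion.

(** * The recursion for isomorphism classes *)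

Lemma tree_classes_rec n e p (d : seq nat) : size d = n -> 0 < e ->
  tree_classes n.+1 e.+1 (rcons d p.+1)
      + \sum_(1 <= j < p) tree_classes n.+1 e (rcons d j)
    = \sum_(i < n) nth 0 d i
        * tree_classes n e (set_nth 0 d i (nth 0 d i + p).-1)
      + tree_classes n.+1 e d.
Proof.
move=> size_d e0; have fact0 := fact_gt0 e.*2.
have := marked_trees_rec p size_d e0; set M := marked_trees _ _ _ _ _.
have E : tree_classes n.+1 e.+1 (rcons d p.+1) * (e.*2)`! = M.
  have := card_labelled_trees e.+1 (rcons d p.+1) (ltn0Sn n).
  rewrite (@card_labelled_marked n e.+1 p.+1 d size_d
    (@ord0 (e.*2).+1) (lift ord0 ord0)) //.
  rewrite -/M doubleS !factS /= -!mulnA.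
  rewrite [_ * ((e.*2).+2 * _)]mulnCA => /eqP; rewrite eqn_pmul2l // => /eqP.
  by rewrite [RHS]mulnCA => /eqP; rewrite eqn_pmul2l // => /eqP <-.
rewrite -E card_labelled_trees //.
under eq_bigr => j _ do rewrite card_labelled_trees //.
under [X in _ = X + _]eq_bigr => i _ do
  rewrite card_labelled_trees ?(leq_ltn_trans _ (ltn_ord i)) // mulnA.
by rewrite -!big_distrl -!mulnDl /= => /eqP; rewrite eqn_pmul2r // => /eqP.
Qed.

(** * The tree with one edge *)

Section OneEdge.

Let i0 : 'I_1.*2 := @ord0 1.
Let i1 : 'I_1.*2 := @ord_max 1.
Let tau : {perm 'I_1.*2} := tperm i0 i1.

Let two_points (x : 'I_1.*2) : x = i0 \/ x = i1.
Proof. by case: x => [[|[|]]] // lt_x; [left|right]; apply: val_inj. Qed.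

Let perm_two_points (s t : {perm 'I_1.*2}) : s i0 = t i0 -> s = t.
Proof.
move=> E0; apply/permP => x; case: (two_points x) => [->//|->].
have st0 : s i1 != t i0 by rewrite -E0 (inj_eq perm_inj).
have tt0 : t i1 != t i0 by rewrite (inj_eq perm_inj).
by case: (two_points (t i0)) (two_points (s i1)) (two_points (t i1)) st0 tt0
  => -> [->|->] [->|->].
Qed.

Let card_porbits1 : #|porbits (1 : {perm 'I_1.*2})| = 2.
Proof.
rewrite /porbits card_imset ?card_ord // => x y.
by rewrite !porbit_fix ?perm1 // => /set1_inj.
Qed.

Let plane_tree_one_edge (a s : {perm 'I_1.*2}) :
  plane_tree 1 a s = (a == tau) && (s == 1%g).
Proof.
apply/plane_treeP/andP => [[_ ma _ cs]|[/eqP-> /eqP->]]; last first.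
  split; rewrite ?card_ord ?card_porbits1 //.
    move=> x; rewrite tpermK; split=> //.
    by case: (two_points x) => ->; rewrite ?tpermL ?tpermR.
  move=> A tA _ x y xA; have t0 := tA i0; rewrite tpermL in t0.
  by case: (two_points x) (two_points y) xA => -> [->|->]; rewrite ?t0.
split; apply/eqP/perm_two_points.
  by rewrite tpermL; case: (two_points (a i0)) (proj2 (ma i0)) => ->; rewrite ?eqxx.
rewrite perm1; case: (two_points (s i0)) => // s0.
have st : s = tau by apply: perm_two_points; rewrite s0 tpermL.
have := card_porbits_mul_tperm 1 i0 i1.
by rewrite mul1g -/tau -st cs card_porbits1 porbit_fix ?perm1 // inE.
Qed.

Let mem_labelled_one_edge N d a s (r : N.-tuple 'I_1.*2) :
  ((a, s, r) \in labelled_trees N 1 d)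
    = [&& a == tau, s == 1%g, uniq r & nseq (size (take (size d) r)) 1 == d].
Proof.
rewrite inE /= plane_tree_one_edge -!andbA; case: eqP => //= _.
case: eqP => //= ->; congr andb.
  by apply: map_inj_uniq => x y; rewrite !porbit_fix ?perm1 // => /set1_inj.
suff -> : [seq #|porbit 1 x| | x <- take (size d) r]
  = nseq (size (take (size d) r)) 1 by [].
by elim: (take _ _) => //= x l <-; rewrite porbit_fix ?perm1 // cards1.
Qed.

Let tree_classes_one_edge N d (R : 'I_1.*2 -> N.-tuple 'I_1.*2) :
    (0 < N)%N -> injective R ->
    (forall r : N.-tuple 'I_1.*2,
      uniq r && (nseq (size (take (size d) r)) 1 == d) <-> exists x, r = R x) ->
  tree_classes N 1 d = 1.
Proof.
move=> N0 R_inj RE; apply/eqP; rewrite -(eqn_pmul2r (fact_gt0 1.*2)).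
rewrite -card_labelled_trees // mul1n; apply/eqP.
have -> : labelled_trees N 1 d = [set (tau, 1%g, R x) | x in [set: 'I_1.*2]].
  apply/setP=> -[[a s] r]; rewrite mem_labelled_one_edge.
  apply/and3P/imsetP => [[/eqP-> /eqP-> /RE[x ->]]|[x _ [-> -> ->]]].
    by exists x.
  by split=> //; apply/RE; exists x.
by rewrite card_imset ?cardsT ?card_ord // => x y [] /R_inj.
Qed.

Lemma tree_classes_1_1 : tree_classes 1 1 [:: 1] = 1.
Proof.
apply: (@tree_classes_one_edge _ _ (fun x => [tuple x])) => // [x y [] //|r].
by case/tupleP: r => x r; rewrite tuple0; split=> // _; exists x.
Qed.

Lemma tree_classes_2_1 : tree_classes 2 1 [:: 1; 1] = 1.
Proof.
apply: (@tree_classes_one_edge _ _ (fun x => [tuple x; tau x])) => // [x y []//|r].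
case/tupleP: r => x r; case/tupleP: r => y r; rewrite tuple0 /=.
split=> [|[z [-> ->]]].
  rewrite inE !andbT => xy; exists x; apply: val_inj; congr [:: _; _].
  by case: (two_points x) (two_points y) xy => -> [->|->] //=;
    rewrite ?tpermL ?tpermR.
rewrite inE !andbT; case: (two_points z) => ->; by rewrite ?tpermL ?tpermR.
Qed.

End OneEdge.

(** * The necessary conditions *)

Lemma sum_card_porbits (H : finType) (s : {perm H}) :
  \sum_(A in porbits s) #|A| = #|H|.
Proof.
have sP : {in [set: H] & &, equivalence_rel (fun x y => porbit s x == porbit s y)}.
  by move=> x y z _ _ _; split=> [|/eqP->].
rewrite -cardsT (card_partition (equivalence_partitionP sP)).
apply: eq_bigl => A; apply/imsetP/imsetP => -[x _ ->]; exists x => //;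
  by apply/setP=> y; rewrite !inE /= eq_porbit_mem porbit_sym.
Qed.

Lemma tree_classes_neq0 N e d : tree_classes N e d != 0 ->
  exists t, t \in labelled_trees N e d.
Proof.
by rewrite -lt0n => /card_gt0P[_ /imsetP[t tD _]]; exists t.
Qed.

Section DegreeBounds.

Variables (N e : nat) (d : seq nat).
Hypothesis classes : tree_classes N e d != 0.

(** The root vertices have total degree [sumn d], each of the other vertices
    has degree at least one, and the total degree is twice the number of edges. *)
Lemma degree_bounds :
  [/\ size d <= N, N <= e.+1, all (leq 1) d, sumn d + e.+1 <= e.*2 + size d
    & size d = e.+1 -> sumn d = e.*2].
Proof.
have [[[a s] r]] := tree_classes_neq0 classes.
rewrite inE => /andP[/andP[/plane_treeP[cH _ _ cs] ur] /eqP dr].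
have kN : size d <= N.
  by rewrite -dr size_map size_take size_tuple; case: ltnP => // /ltnW.
pose cyc := [seq porbit s x | x <- take (size d) r].
have dE : d = [seq #|A| | A : {set _} <- cyc] by rewrite -map_comp -[LHS]dr.
have uc : uniq cyc by rewrite /cyc map_take take_uniq.
have cP : {subset cyc <= porbits s} by move=> _ /mapP[x _ ->]; apply: imset_f.
have sum_d : sumn d = \sum_(A in cyc) #|A| by rewrite dE sumnE big_map big_uniq.
have card_cyc : #|cyc| = size d by rewrite (card_uniqP uc) dE size_map.
have tot := sum_card_porbits s.
rewrite cH (bigID (mem cyc)) /= in tot.
have E : \sum_(A in porbits s | A \in cyc) #|A| = sumn d.
  by rewrite sum_d; apply: eq_bigl => A; apply: andb_idl => /cP.
rewrite E in tot.
have card_rest : #|[set A in porbits s | A \notin cyc]| + size d = e.+1.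
  rewrite -cs -card_cyc -(cardsID [set A in cyc] (porbits s)) addnC; congr (_ + _).
    by apply: eq_card => A; rewrite !inE andb_idl // => /cP.
  by apply: eq_card => A; rewrite !inE andbC.
split=> //.
- rewrite -cs -[N](size_tuple r) -(size_map (porbit s)) -(card_uniqP ur).
  by apply/subset_leq_card/subsetP => _ /mapP[x _ ->]; apply: imset_f.
- rewrite dE; apply/allP => _ /mapP[A /cP/imsetP[x _ ->] ->].
  by rewrite lt0n card_porbit_neq0.
- rewrite -tot -card_rest -addnA leq_add2l leq_add2r -sum1dep_card.
  by apply: leq_sum => A /andP[/imsetP[x _ ->] _]; rewrite lt0n card_porbit_neq0.
move=> kE; rewrite -tot big_pred0 ?addn0 // => A.
have /eqP : #|[set A in porbits s | A \notin cyc]| = 0.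
  by apply: (@addIn (size d)); rewrite card_rest kE.
by rewrite cards_eq0 => /eqP/setP/(_ A); rewrite !inE.
Qed.

End DegreeBounds.

Lemma leq_sumn_size d : all (leq 1) d -> size d <= sumn d.
Proof. by elim: d => //= x d IH /andP[x1 /IH]; lia. Qed.

Lemma leq_mem_sumn d x : all (leq 1) d -> x \in d -> x + size d <= (sumn d).+1.
Proof.
elim: d => //= y d IH /andP[y1 dge1].
rewrite inE => /predU1P[->|/(IH dge1)]; last by lia.
by have := leq_sumn_size dge1; lia.
Qed.

Lemma sumn_all1 d : count (pred1 1) d = size d -> sumn d = size d.
Proof.
move/eqP; rewrite -all_count; elim: d => //= x d IH /andP[/eqP-> /IH->].
by rewrite add1n.
Qed.

Import Order.TTheory GRing.Theory Num.Theory.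

Local Open Scope ring_scope.

Lemma sum_Posz d : \sum_(x <- [seq x%:Z | x <- d]) x = (sumn d)%:Z.
Proof. by elim: d => [|x d IH]; rewrite ?big_nil //= big_cons IH PoszD. Qed.

Lemma count_Posz d : count (pred1 (1 : int)) [seq x%:Z | x <- d] = count (pred1 1%N) d.
Proof. by rewrite count_map; apply: eq_count => x /=; rewrite eqz_nat. Qed.

Lemma tree_classes_necessary N e d : (0 < N)%N ->
  tree_classes N e d != 0%N -> necessary N e%:Z [seq x%:Z | x <- d].
Proof.
move=> N0 /degree_bounds[kN Ne d1 sum_d full].
rewrite /necessary size_map sum_Posz count_Posz kN N0 /=.
have k_full : (size d <= e.+1)%N by apply: leq_trans Ne.
apply/and5P; split.
- by rewrite andbT; lia.
- apply/allP => _ /mapP[x xd ->]; have := allP d1 x xd.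
  have := leq_mem_sumn d1 xd => le_x /= x1.
  by apply/andP; split; lia.
- apply/andP; split; first by lia.
  apply/eqP; apply/idP/idP.
    by case/andP=> /eqP kE /eqP NE; rewrite full //; lia.
  by move/eqP => sE; apply/andP; split; apply/eqP; lia.
- apply/implyP => e2; rewrite lez_nat leqNgt; apply/negP => lt_c.
  have sd : size d = e.+1.
    by apply/eqP; rewrite eqn_leq k_full (leq_trans lt_c) ?count_size.
  have c_all : count (pred1 1%N) d = size d.
    by apply/eqP; rewrite eqn_leq count_size sd.
  by have := full sd; rewrite sumn_all1 // sd; lia.
apply/implyP => _; apply: leq_trans (count_size _ _) _.
by rewrite size_take size_map; case: ltnP.
Qed.

Lemma T_pos N e d : (0 < N)%N -> (0 < e)%N ->
  T N e%:Z [seq x%:Z | x <- d] = tree_classes N e d.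
Proof.
move=> N0 e0; rewrite /T /trivial_case eqz_nat (gtn_eqF e0) andbF /=.
have -> : [seq `|x|%N | x <- [seq x%:Z | x <- d]] = d.
  by rewrite -map_comp map_id.
case: ifPn => //; apply: contraNeq; rewrite eq_sym; exact: tree_classes_necessary.
Qed.

Lemma T_neg N (e : int) d : e < 0 -> T N e d = 0%N.
Proof.
move=> e0; rewrite /T /trivial_case /necessary (lt_eqF e0) andbF /=.
by case: ifP => // /and3P[_ H _]; lia.
Qed.

(** * The recursion *)

Lemma sum_PoszE (I : Type) (l : seq I) (P : pred I) (F : I -> nat) :
  (\sum_(i <- l | P i) F i)%N%:Z = \sum_(i <- l | P i) (F i)%:Z.
Proof. exact: (big_morph Posz PoszD). Qed.

Lemma set_nth_Posz d i v : (i < size d)%N ->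
  set_nth 0 [seq x%:Z | x <- d] i v%:Z = [seq x%:Z | x <- set_nth 0%N d i v].
Proof. by elim: d i => [|x d IH] [|i] //= /IH->. Qed.

Lemma T_no_edge N d : T N 0 d = trivial_case N 0 d.
Proof.
rewrite /T; case: ifPn => // triv; case: ifP => // /and5P[_ /andP[N0 N1] d0 _ _].
have NE : N = 1%N by lia.
case: d triv d0 => [|x d]; first by rewrite NE /trivial_case !eqxx inE.
by move=> _ /andP[]; lia.
Qed.

Lemma T_rec_le0 (N : nat) (e : int) (d : seq nat) (dN : nat) :
    (1 <= dN)%N -> e <= 0 ->
  let ds := [seq x%:Z | x <- d] in
  (T N e (rcons ds dN%:Z))%:Z =
    \sum_(i < N.-1)
        ds`_i * (T N.-1 (e - 1) (set_nth 0 ds i (ds`_i + dN%:Z - 2)))%:Z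
    + (T N (e - 1) ds)%:Z
    - \sum_(1 <= j < dN.-1) (T N (e - 1) (rcons ds j%:Z))%:Z.
Proof.
move=> dN1 e0 ds; have e1 : e - 1 < 0 by lia.
have Te1 M l : T M (e - 1) l = 0%N by apply: T_neg.
rewrite big1 => [|i _]; last by rewrite Te1 mulr0.
rewrite Te1 big1 => [|j _]; last by rewrite Te1.
have [->|ne] := eqVneq e 0; last by rewrite T_neg //; lia.
rewrite T_no_edge /trivial_case.
suff -> : (rcons ds dN%:Z \in [:: [::]; [:: 0]]) = false by rewrite !andbF.
rewrite !inE; case: {Te1} ds => [|x [|y l]] /=; rewrite ?eqseq_cons ?andbF ?andbT //.
by rewrite eqz_nat; case: dN dN1.
Qed.

Lemma T_rec_one_edge (N : nat) (d : seq nat) (dN : nat) :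
    (1 <= N)%N -> size d = N.-1 -> (1 <= dN)%N -> ~ (N = 1%N /\ (2 <= dN)%N) ->
  let ds := [seq x%:Z | x <- d] in
  (T N 1 (rcons ds dN%:Z))%:Z =
    \sum_(i < N.-1)
        ds`_i * (T N.-1 0 (set_nth 0 ds i (ds`_i + dN%:Z - 2)))%:Z
    + (T N 0 ds)%:Z
    - \sum_(1 <= j < dN.-1) (T N 0 (rcons ds j%:Z))%:Z.
Proof.
case: N => [|[|[|N]]] // _ size_d dN1 nondeg ds.
- have dNE : dN = 1%N.
    by apply/eqP; rewrite eqn_leq dN1 andbT leqNgt; apply/negP => ?; apply: nondeg.
  move: size_d; rewrite /ds; case: d {ds} => // _.
  rewrite dNE big_ord0 big_geq // T_no_edge.
  by rewrite (@T_pos 1 1 [:: 1%N]) // tree_classes_1_1.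
- move: size_d; rewrite /ds; case: d {ds} => [|a [|]] // _.
  rewrite big_ord1 T_no_edge big1 => [|j _]; last by rewrite T_no_edge.
  rewrite !T_no_edge /= (@T_pos 2 1 [:: a; dN]) //.
  rewrite /trivial_case /= addr0 subr0.
  have bounds : tree_classes 2 1 [:: a; dN] != 0%N -> a = 1%N /\ dN = 1%N.
    by case/degree_bounds => _ _ /= /and3P[] /=; lia.
  have [/andP[/eqP-> /eqP->]|ne] := boolP ((a == 1%N) && (dN == 1%N)).
    by rewrite tree_classes_2_1 mul1r inE.
  have -> : tree_classes 2 1 [:: a; dN] = 0%N.
    by apply/eqP; apply: contraNT ne => /bounds[-> ->].
  have [->|a0] := posnP a; first by rewrite mul0r.
  rewrite !inE eqseq_cons andbT /=; case: (_ - 2 =P 0) => E; rewrite ?mulr0 //.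
  by case/negP: ne; apply/andP; split; apply/eqP; lia.
rewrite big1 => [|i _]; last by rewrite T_no_edge mulr0.
rewrite T_no_edge big1 => [|j _]; last by rewrite T_no_edge.
rewrite -map_rcons (@T_pos _ 1) //; apply/eqP; rewrite eqz_nat.
by apply/negPn/negP => /degree_bounds[].
Qed.

(** Here every value of [T] with a non-zero coefficient is a number of trees, and
    the recursion for isomorphism classes applies. *)
Lemma T_rec_gt1 (N : nat) (e : nat) (d : seq nat) (dN : nat) :
    (1 <= N)%N -> size d = N.-1 -> (1 <= dN)%N -> (0 < e)%N ->
  let ds := [seq x%:Z | x <- d] in
  (T N e.+1 (rcons ds dN%:Z))%:Z =
    \sum_(i < N.-1)
        ds`_i * (T N.-1 e (set_nth 0 ds i (ds`_i + dN%:Z - 2)))%:Z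
    + (T N e ds)%:Z
    - \sum_(1 <= j < dN.-1) (T N e (rcons ds j%:Z))%:Z.
Proof.
case: N => // n _ size_d; case: dN => // p _ e0 ds; rewrite -!pred_Sn in size_d *.
rewrite -map_rcons T_pos // T_pos //.
apply/eqP; rewrite eq_sym subr_eq eq_sym; apply/eqP.
under [X in _ + X = _]eq_bigr => j _ do rewrite -map_rcons T_pos //.
rewrite -sum_PoszE -PoszD tree_classes_rec // PoszD sum_PoszE.
congr (_ + _); apply: eq_bigr => i _; have i_lt : (i < size d)%N by rewrite size_d.
(* [d_i + d_N - 2] is negative only for [d_i = 0], where its term vanishes. *)
rewrite PoszM (nth_map 0%N) //; have [->|di] := posnP (nth 0%N d i).
  by rewrite !mul0r.
have -> : (nth 0%N d i)%:Z + p.+1%:Z - 2 = (nth 0%N d i + p).-1%:Z by lia.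
by rewrite set_nth_Posz // T_pos // (leq_ltn_trans _ (ltn_ord i)).
Qed.

(* d lists d_1, ..., d_{N-1} and dN is d_N. *)
Theorem theorem2 (N : nat) (e : int) (d : seq nat) (dN : nat)
    (N_ge1 : (1 <= N)%N) (size_d : size d = N.-1) (dN_ge1 : (1 <= dN)%N)
    (nondeg : ~ [/\ N = 1%N, e = 1 & (2 <= dN)%N]) :
  let ds := [seq x%:Z | x <- d] in
  (T N e (rcons ds dN%:Z))%:Z =
    \sum_(i < N.-1)
        ds`_i * (T N.-1 (e - 1) (set_nth 0 ds i (ds`_i + dN%:Z - 2)))%:Z
    + (T N (e - 1) ds)%:Z
    - \sum_(1 <= j < dN.-1) (T N (e - 1) (rcons ds j%:Z))%:Z.
Proof.
have [e0|e0] := leP e 0; first exact: T_rec_le0.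
case: e e0 nondeg => // -[|[|e]] // _ nondeg ds.
  by rewrite subrr; apply: T_rec_one_edge => // -[N1 dN2]; apply: nondeg.
have -> : e.+2%:Z - 1 = e.+1 by lia.
exact: T_rec_gt1.
Qed.
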